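(* Let $k$ be a field, let $A$ be a finite-dimensional hereditary $k$-algebra with radical $r$, and let $\mathcal M=(A_i,{}_iM_j)$ be its related pseudo-modulation, of pseudo-valued quiver $(\mathcal G,\mathcal D,\Omega)$. If $A/r$ is separable, then the representation category $\mathrm{Rep}(\mathcal M)$ is equivalent to the module category $\mathrm{Mod}_A$, and the category $\mathrm{rep}(\mathcal M)$ of finitely generated representations is equivalent to the category $\mathrm{mod}_A$ of finitely generated $A$-modules.
   Context: Modules are right modules. The related pseudo-modulation of $A$: write $A/r=\bigoplus_{i=1}^sA_i$ with $A_i$ the simple two-sided ideals of $A/r$; $r/r^2$ is an $A/r$-$A/r$-bimodule in the natural way, and ${}_iM_j=A_i\cdot (r/r^2)\cdot A_j$ is an $A_i$-$A_j$-bimodule for $i,j=1,\dots,s$. Its pseudo-valued quiver has vertex set $\mathcal G=\{1,\dots,s\}$, an oriented edge $i\to j$ whenever ${}_iM_j\neq0$, and on this edge the valuation $(d_{ij},d_{ji})$ with $d_{ij}=\mathrm{rank}(({}_iM_j)_{A_j})$, $d_{ji}=\mathrm{rank}({}_{A_i}({}_iM_j))$, where rank is the minimal number of generators. A representation of $\mathcal M$ is $\mathcal V=(V_i,{}_j\varphi_i)$ with a right $A_i$-module $V_i$ for each $i\in\mathcal G$ and an $A_j$-homomorphism ${}_j\varphi_i:V_i\otimes_{A_i}{}_iM_j\to V_j$ for each oriented edge $i\to j$; it is finitely generated if each $V_i$ is finitely generated over $A_i$. A morphism $(V_i,{}_j\varphi_i)\to(U_i,{}_j\psi_i)$ is a family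 of $A_i$-homomorphisms $\alpha_i:V_i\to U_i$ with $\alpha_j\circ{}_j\varphi_i={}_j\psi_i\circ(\alpha_i\otimes\mathrm{id}_{{}_iM_j})$ for each oriented edge $i\to j$. $\mathrm{Rep}(\mathcal M)$ (resp. $\mathrm{rep}(\mathcal M)$) is the category of all (resp. finitely generated) representations. *)

(* Defs.v *)
From HB Require Import structures.
From mathcomp Require Import all_boot all_order all_algebra all_field.
From mathcomp Require Import generic_quotient ring_quotient boolp freeg.

Set Implicit Arguments.
Unset Strict Implicit.
Unset Printing Implicit Defensive.

Import GRing.Theory.
Local Open Scope ring_scope.
Local Open Scope quotient_scope.

(* A right R-module is an lmodType over the converse ring R^c, the right      *)
(* action v . a being written a *: v; in particular (R^c)^o is R as a right   *)
(* module over itself.                                                        *)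

Section Modules.
Variables (R : nzRingType) (V : lmodType R).

Definition generated_by (n : nat) : Prop :=
  exists g : 'I_n -> V, forall v, exists c : 'I_n -> R, v = \sum_i c i *: g i.

Definition fin_gen : Prop := exists n, generated_by n.

(* The junk value 0 is taken when V is not finitely generated. *)
Definition rank : nat :=
  if pselect (exists n, `[< generated_by n >]) is left h
  then ex_minn h else 0%N.

Definition projective : Prop :=
  forall (X Y : lmodType R) (p : {linear X -> Y}) (f : {linear V -> Y}),
    (forall y, exists x, p x = y) ->
  exists g : {linear V -> X}, forall v, p (g v) = f v.

End Modules.

Lemma linear_eq (R : nzRingType) (U V : lmodType R) (f g : {linear U -> V}) :
  f =1 g -> f = g.
Proof.
case: f g => [f [[fD] [fZ]]] [g [[gD] [gZ]]] /= /funext fg.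
move: fg gD gZ => {g} <- gD gZ.
by rewrite (Prop_irrelevance fD gD) (Prop_irrelevance fZ gZ).
Qed.

Section QuotientSpace.
Variables (k : fieldType) (V : vectType k) (U : {vspace V}).

Definition vquot : Type := Quotient.quot (pred_of_vspace U).
HB.instance Definition _ := GRing.Zmodule.on vquot.
HB.instance Definition _ := Quotient.on vquot.

Definition vpi (v : V) : vquot := \pi_vquot v.

Implicit Types (x y : vquot) (v w : V).

Lemma vpi_eq v w : (vpi v == vpi w) = (v - w \in U).
Proof. by rewrite [RHS](Quotient.idealrBE (pred_of_vspace U)). Qed.

Lemma vpiK x : vpi (repr x) = x. Proof. exact: reprK. Qed.

Lemma vpiB : zmod_morphism vpi.
Proof.
move=> v w; rewrite /vpi; have piB := pi_is_zmod_morphism.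
exact: (piB _ _ _ (Quotient.quot (pred_of_vspace U))).
Qed.
HB.instance Definition _ := GRing.isZmodMorphism.Build V vquot vpi vpiB.

Lemma vpi_eq0 v : (vpi v == 0) = (v \in U).
Proof. by rewrite -(raddf0 vpi) vpi_eq subr0. Qed.

Lemma repr_vpi v : repr (vpi v) - v \in U.
Proof. by rewrite -vpi_eq vpiK. Qed.

Definition vquot_scale (a : k) x : vquot := vpi (a *: repr x).

Lemma vpi_scale a v : vquot_scale a (vpi v) = vpi (a *: v).
Proof. by apply/eqP; rewrite vpi_eq -scalerBr memvZ ?repr_vpi. Qed.

Fact vquot_scaleA a b x :
  vquot_scale a (vquot_scale b x) = vquot_scale (a * b) x.
Proof. by rewrite -(vpiK x) !vpi_scale scalerA. Qed.
Fact vquot_scale1 : left_id 1 vquot_scale.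
Proof. by move=> x; rewrite -(vpiK x) vpi_scale scale1r. Qed.
Fact vquot_scaleDr : right_distributive vquot_scale +%R.
Proof.
move=> a x y; rewrite -(vpiK x) -(vpiK y) -raddfD !vpi_scale -raddfD.
by rewrite scalerDr.
Qed.
Fact vquot_scaleDl x : {morph vquot_scale^~ x : a b / a + b}.
Proof. by move=> a b; rewrite -(vpiK x) !vpi_scale -raddfD scalerDl. Qed.
HB.instance Definition _ := GRing.Zmodule_isLmodule.Build k vquot
  vquot_scaleA vquot_scale1 vquot_scaleDr vquot_scaleDl.

Fact vpiZ : scalable vpi. Proof. by move=> a v; rewrite -vpi_scale. Qed.
HB.instance Definition _ := GRing.isScalable.Build k V vquot *:%R vpi vpiZ.

(* The complement U^C maps isomorphically onto the quotient. *)
Definition vquot_coord x : 'rV[k]_(\dim (U^C)%VS) :=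
  \row_i coord (vbasis (U^C)%VS) i (daddv_pi (U^C)%VS U (repr x)).

Lemma vquot_compl : (U^C :&: U = 0)%VS.
Proof. by rewrite capvC capv_compl. Qed.

Lemma vquot_decomp v : daddv_pi (U^C)%VS U v + daddv_pi U (U^C)%VS v = v.
Proof.
by apply: daddv_pi_add; rewrite ?vquot_compl // addvC addv_complf memvf.
Qed.

Lemma daddv_vpi v : daddv_pi (U^C)%VS U (repr (vpi v)) = daddv_pi (U^C)%VS U v.
Proof.
apply/eqP; rewrite -subr_eq0 -linearB; apply/eqP.
move: (repr_vpi v) => /(daddv_pi_id (capv_compl U)) E.
apply: (addIr (repr (vpi v) - v)); rewrite add0r.
by have := vquot_decomp (repr (vpi v) - v); rewrite E.
Qed.

Fact vquot_vect_iso : Vector.axiom (\dim (U^C)%VS) vquot.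
Proof.
exists vquot_coord.
  move=> a x y; apply/rowP=> i; rewrite !mxE.
  by rewrite -{1}(vpiK x) -{1}(vpiK y) -linearP daddv_vpi !linearP.
exists (fun c : 'rV_(\dim (U^C)%VS) =>
          vpi (\sum_i c 0 i *: (vbasis (U^C)%VS)`_i)).
  move=> x; under eq_bigr => i _ do rewrite mxE.
  rewrite -(coord_vbasis (memv_pi _ _ _)) -[RHS]vpiK; apply/eqP; rewrite vpi_eq.
  by rewrite -{2}[repr x]vquot_decomp opprD addrA subrr add0r memvN memv_pi.
move=> c; apply/rowP=> i; rewrite mxE daddv_vpi daddv_pi_id ?vquot_compl //.
  by rewrite coord_sum_free ?(basis_free (vbasisP _)).
by apply: rpred_sum => j _; rewrite rpredZ ?vbasis_mem ?memt_nth.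
Qed.
HB.instance Definition _ := Lmodule_hasFinDim.Build k vquot vquot_vect_iso.

End QuotientSpace.

Section Intersection.
Variables (k : fieldType) (V : vectType k) (P : {vspace V} -> Prop).

Fact vinter_subproof :
  exists W : {vspace V}, forall x, x \in W <-> (forall U, P U -> x \in U).
Proof.
pose Q (s : seq {vspace V}) := forall U, U \in s -> P U.
pose dimQ n := `[< exists2 s, Q s & \dim (\bigcap_(U <- s) U)%VS = n >].
have exQ : exists n, dimQ n.
  by exists (\dim {:V}); apply/asboolP; exists [::]; rewrite ?big_nil.
have [n /asboolP[s Qs <-] min_n] := ex_minnP exQ.
exists (\bigcap_(U <- s) U)%VS => x; split=> [xs U PU|xP].
  have : (U :&: \bigcap_(U0 <- s) U0 == \bigcap_(U0 <- s) U0)%VS.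
    rewrite eqEdim capvSr min_n //; apply/asboolP; exists (U :: s).
      by move=> W; rewrite inE => /predU1P[-> //|]; apply: Qs.
    by rewrite big_cons.
  by move=> /eqP E; move: xs; rewrite -E memv_cap => /andP[].
elim: s Qs {min_n} => [|U s IHs] Qs; first by rewrite big_nil memvf.
have xU : x \in U by apply/xP/Qs/mem_head.
rewrite big_cons memv_cap xU; apply: IHs => W Ws.
by apply: Qs; rewrite inE Ws orbT.
Qed.
Definition vinter : {vspace V} := sval (cid vinter_subproof).

Lemma vinterP x : x \in vinter <-> (forall U, P U -> x \in U).
Proof. by rewrite /vinter; case: cid => W /= /(_ x). Qed.

End Intersection.

Section Algebra.
Variables (k : fieldType) (A : falgType k).
Implicit Types (U W : {vspace A}) (x y : A).

Definition right_ideal U : bool := (U * {:A} <= U)%VS.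
Definition left_ideal U : bool := ({:A} * U <= U)%VS.
Definition two_sided_ideal U : bool := left_ideal U && right_ideal U.

Definition maximal_right_ideal U : Prop :=
  [/\ right_ideal U, U != fullv
    & forall W, right_ideal W -> (U <= W)%VS -> W = U \/ W = fullv].

(* The minimal nonzero two-sided ideals. *)
Definition simple_ideal U : Prop :=
  [/\ two_sided_ideal U, U != 0%VS
    & forall W, two_sided_ideal W -> (W <= U)%VS -> W = 0%VS \/ W = U].

(* The Jacobson radical. *)
Definition radical : {vspace A} := vinter maximal_right_ideal.

Lemma right_idealP U :
  reflect {in U, forall x y, x * y \in U} (right_ideal U).
Proof.
apply: (iffP idP) => [RU x xU y|RU]; last by apply/prodvP=> x y xU _; apply: RU.
by apply: (subvP RU); rewrite memv_mul ?memvf.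
Qed.

Lemma maximal_right_ideal_ex : exists U, maximal_right_ideal U.
Proof.
pose Q n := `[< exists U, [/\ right_ideal U, U != fullv & \dim U = n] >].
have exQ : exists n, Q n.
  exists 0%N; apply/asboolP; exists 0%VS; rewrite dimv0; split=> //.
    by rewrite /right_ideal prod0v sub0v.
  by rewrite eq_sym -dimv_eq0 dimvf -lt0n FalgType_proper.
have ubQ n : Q n -> (n <= dim A)%N.
  by move=> /asboolP[U [_ _ <-]]; rewrite -dimvf dimvS ?subvf.
have [n /asboolP[U [RU nU <-]] max_n] := ex_maxnP exQ ubQ.
exists U; split=> // W RW sUW.
have [->|nW] := eqVneq W fullv; [by right | left; apply/esym/eqP].
by rewrite eqEdim sUW max_n //; apply/asboolP; exists W.
Qed.

Lemma radicalMr x y : x \in radical -> x * y \in radical.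
Proof.
move=> /vinterP xr; apply/vinterP => U mU; have [/right_idealP RU _ _] := mU.
exact/RU/xr.
Qed.

Lemma radicalMl x y : x \in radical -> y * x \in radical.
Proof.
move=> /vinterP xr; apply/vinterP => U mU; have [/right_idealP RU _ maxU] := mU.
have [yU|yU] := boolP (y \in U); first exact: RU.
pose W := (amull y @^-1: U)%VS.
have memW z : (z \in W) = (y * z \in U) by rewrite -memv_preim !lfunE.
rewrite -memW; apply: xr; split.
- by apply/right_idealP=> z; rewrite memW => zW t; rewrite memW mulrA RU.
- by apply: contraNneq yU => WA; rewrite -[y]mulr1 -memW WA memvf.
move=> W' /right_idealP RW' sWW'.
have [|nW'] := eqVneq W' W; [by left | right].
have [z zW' zU] : exists2 z, z \in W' & y * z \notin U.
  apply: contrapT => nex; case/eqP: nW'; apply/eqP; rewrite eqEsubv sWW' andbT.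
  apply/subvP=> z zW'; rewrite memW; apply: contrapT => /negP zU.
  by apply: nex; exists z.
have : (y \in U + amull y @: W')%VS.
  have [||E|->] := maxU (U + amull y @: W')%VS; rewrite ?addvSl ?memvf //.
    apply/right_idealP=> _ /memv_addP[u uU [_ /memv_imgP[w wW' ->] ->]] v.
    rewrite mulrDl memv_add ?RU // !lfunE /= -mulrA.
    by rewrite -[y * _](lfunE (y \*o idfun)) memv_img ?RW'.
  case/negP: zU; rewrite -E -[y * _]add0r memv_add ?mem0v //.
  by rewrite -[y * _](lfunE (y \*o idfun)) memv_img.
case/memv_addP=> u uU [_ /memv_imgP[w wW' ->]]; rewrite !lfunE /= => yE.
have : 1 - w \in W by rewrite memW mulrBr mulr1 {1}yE addrK.
move=> /(subvP sWW') /(rpredD wW'); rewrite addrC subrK => W'1.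
by apply/vspaceP=> v; rewrite memvf -[v]mul1r RW'.
Qed.

Lemma radical1 : 1 \notin radical.
Proof.
have [U mU] := maximal_right_ideal_ex; have [/right_idealP RU nU _] := mU.
apply: contraNN nU => /vinterP/(_ U mU) U1; apply/eqP/vspaceP=> v.
by rewrite memvf -[v]mul1r RU.
Qed.

Definition semitop : Type := vquot radical.
HB.instance Definition _ := Vector.on semitop.

Definition semitop_pi (a : A) : semitop := vpi radical a.
Fact semitop_pi_linear : linear semitop_pi. Proof. exact: linearP. Qed.
HB.instance Definition _ :=
  GRing.isLinear.Build k A semitop *:%R semitop_pi semitop_pi_linear.

Definition semitop_mul (x y : semitop) : semitop :=
  semitop_pi (repr x * repr y).

Lemma semitop_piM x y :
  semitop_mul (semitop_pi x) (semitop_pi y) = semitop_pi (x * y).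
Proof.
apply/eqP; rewrite vpi_eq.
rewrite -[repr (semitop_pi x)](subrK x) -[repr (semitop_pi y)](subrK y).
rewrite mulrDl -addrA memvD ?radicalMr ?repr_vpi //.
by rewrite mulrDr addrK radicalMl ?repr_vpi.
Qed.

Lemma semitop_piK (x : semitop) : semitop_pi (repr x) = x.
Proof. exact: vpiK. Qed.

Fact semitop_mulA : associative semitop_mul.
Proof.
by move=> x y z; rewrite -(semitop_piK x) -(semitop_piK y) -(semitop_piK z)
  !semitop_piM mulrA.
Qed.
Fact semitop_mul1 : left_id (semitop_pi 1) semitop_mul.
Proof. by move=> x; rewrite -(semitop_piK x) semitop_piM mul1r. Qed.
Fact semitop_mulr1 : right_id (semitop_pi 1) semitop_mul.
Proof. by move=> x; rewrite -(semitop_piK x) semitop_piM mulr1. Qed.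
Fact semitop_mulDl : left_distributive semitop_mul +%R.
Proof.
move=> x y z; rewrite -(semitop_piK x) -(semitop_piK y) -(semitop_piK z).
by rewrite -raddfD !semitop_piM -raddfD mulrDl.
Qed.
Fact semitop_mulDr : right_distributive semitop_mul +%R.
Proof.
move=> x y z; rewrite -(semitop_piK x) -(semitop_piK y) -(semitop_piK z).
by rewrite -raddfD !semitop_piM -raddfD mulrDr.
Qed.
Fact semitop_1_neq0 : semitop_pi 1 != 0.
Proof. by rewrite vpi_eq0 radical1. Qed.
HB.instance Definition _ := GRing.Zmodule_isNzRing.Build semitop
  semitop_mulA semitop_mul1 semitop_mulr1 semitop_mulDl semitop_mulDr
  semitop_1_neq0.

Fact semitop_pi_monoid : monoid_morphism semitop_pi.
Proof. by split=> // x y; apply/esym/semitop_piM. Qed.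
HB.instance Definition _ :=
  GRing.isMonoidMorphism.Build A semitop semitop_pi semitop_pi_monoid.

Fact semitop_scaleAl (a : k) (x y : semitop) : a *: (x * y) = a *: x * y.
Proof.
rewrite -(semitop_piK x) -(semitop_piK y) -rmorphM -!linearZ -rmorphM.
by rewrite scalerAl.
Qed.
HB.instance Definition _ := GRing.Lmodule_isLalgebra.Build k semitop
  semitop_scaleAl.

Fact semitop_scaleAr (a : k) (x y : semitop) : a *: (x * y) = x * (a *: y).
Proof.
rewrite -(semitop_piK x) -(semitop_piK y) -rmorphM -!linearZ -rmorphM.
by rewrite scalerAr.
Qed.
HB.instance Definition _ := GRing.Lalgebra_isAlgebra.Build k semitop
  semitop_scaleAr.
HB.instance Definition _ := Algebra_isFalgebra.Build k semitop.

End Algebra.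

(* An R-S-bimodule: a right S-module with a commuting left R-action. *)
Record bimodule (R S : nzRingType) := Bimodule {
  bim_right :> lmodType S^c;
  lact : R -> bim_right -> bim_right;
  lactA : forall a b m, lact a (lact b m) = lact (a * b) m;
  lact1 : forall m, lact 1 m = m;
  lactDr : forall a m n, lact a (m + n) = lact a m + lact a n;
  lactDl : forall a b m, lact (a + b) m = lact a m + lact b m;
  lactZ : forall a (s : S^c) m, lact a (s *: m) = s *: lact a m }.

Arguments lact {R S} b _ _ : rename.

Section LeftModule.
Variables (R S : nzRingType) (M : bimodule R S).

Definition bim_left : Type := M.
HB.instance Definition _ := GRing.Zmodule.on bim_left.

Fact bim_left_DDl (m : bim_left) :
  {morph (fun a => lact M a m : bim_left) : a b / a + b}.
Proof. by move=> a b; apply: lactDl. Qed.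
HB.instance Definition _ := GRing.Zmodule_isLmodule.Build R bim_left
  (@lactA R S M) (@lact1 R S M) (@lactDr R S M) bim_left_DDl.

End LeftModule.

(* V (x)_R M is the free abelian group on V * M modulo the subgroup generated *)
(* by the usual relators.                                                     *)
Section Tensor.
Variables (R S : nzRingType) (V : lmodType R^c) (M : bimodule R S).

Local Notation F := {freeg (V * M) / int}.

Inductive tensor_relator : F -> Prop :=
| tensor_relatorDl v w m :
    tensor_relator (<< (v + w, m) >> - << (v, m) >> - << (w, m) >>)
| tensor_relatorDr v m n :
    tensor_relator (<< (v, m + n) >> - << (v, m) >> - << (v, n) >>)
| tensor_relatorZ v (a : R) m :
    tensor_relator (<< ((a : R^c) *: v, m) >> - << (v, lact M a m) >>).

Definition tensor_null : {pred F} := fun x =>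
  `[< forall G : zmodClosed F,
        (forall y, tensor_relator y -> y \in G) -> x \in G >].

Fact tensor_null_zmod_closed : zmod_closed tensor_null.
Proof.
split=> [|x y /asboolP xN /asboolP yN]; apply/asboolP=> G relG.
  exact: rpred0.
by rewrite rpredB ?xN ?yN.
Qed.
HB.instance Definition _ := GRing.isZmodClosed.Build F tensor_null
  tensor_null_zmod_closed.

Definition tensor : Type := Quotient.quot tensor_null.
HB.instance Definition _ := GRing.Zmodule.on tensor.
HB.instance Definition _ := Quotient.on tensor.

Definition tensor_pi (x : F) : tensor := \pi_tensor x.

Fact tensor_pi_zmod : zmod_morphism tensor_pi.
Proof.
have piB := pi_is_zmod_morphism.
by move=> x y; exact: (piB _ _ _ (Quotient.quot tensor_null)).
Qed.
HB.instance Definition _ :=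
  GRing.isZmodMorphism.Build F tensor tensor_pi tensor_pi_zmod.

Lemma tensor_pi_eq x y : (tensor_pi x == tensor_pi y) = (x - y \in tensor_null).
Proof. by rewrite [RHS](Quotient.idealrBE tensor_null). Qed.

Definition tens (v : V) (m : M) : tensor := tensor_pi << (v, m) >>.

Lemma relator_null x : tensor_relator x -> tensor_pi x = 0.
Proof.
move=> relx; apply/eqP; rewrite -(raddf0 tensor_pi) tensor_pi_eq subr0.
by apply/asboolP=> G; apply.
Qed.

Lemma tensDl v w m : tens (v + w) m = tens v m + tens w m.
Proof.
have := relator_null (tensor_relatorDl v w m); rewrite !raddfB /= => /eqP.
by rewrite -addrA -opprD subr_eq0 => /eqP.
Qed.
Lemma tensDr v m n : tens v (m + n) = tens v m + tens v n.
Proof.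
have := relator_null (tensor_relatorDr v m n); rewrite !raddfB /= => /eqP.
by rewrite -addrA -opprD subr_eq0 => /eqP.
Qed.
Lemma tensZ v (a : R) m : tens ((a : R^c) *: v) m = tens v (lact M a m).
Proof.
have := relator_null (tensor_relatorZ v a m); rewrite !raddfB /= => /eqP.
by rewrite subr_eq0 => /eqP.
Qed.

Lemma tensor_ind (P : tensor -> Prop) :
  P 0 -> (forall x y, P x -> P y -> P (x - y)) -> (forall v m, P (tens v m)) ->
  forall x, P x.
Proof.
move=> P0 PB Pt x.
have PN y : P y -> P (- y) by move=> Py; rewrite -sub0r; apply: PB.
have PD y z : P y -> P z -> P (y + z).
  by move=> Py Pz; rewrite -[z]opprK; apply/PB/PN.
have -> : x = tensor_pi (repr x) by rewrite /tensor_pi reprK.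
rewrite -(freeg_sumE (repr x)) raddf_sum.
apply: (big_ind P) => // -[v m] _.
have -> (c : int) : << c *g (v, m) >> = << (v, m) >> *~ c :> F.
  by rewrite freegU_mulz intz.
rewrite raddfMz /=; have PM n : P (tens v m *+ n).
  by elim: n => [|n IHn]; rewrite ?mulr0n // mulrS; apply: PD.
by case: (coeff _ _) => n; rewrite ?NegzE ?mulrNz -?pmulrn; [|apply: PN].
Qed.

(* The additive map on the tensor product induced by a balanced map. *)
Section Lift.
Variables (W : zmodType) (f : V -> M -> W).

Definition balanced : Prop :=
  [/\ forall v w m, f (v + w) m = f v m + f w m,
      forall v m n, f v (m + n) = f v m + f v n
    & forall v (a : R) m, f ((a : R^c) *: v) m = f v (lact M a m)].

Let g : F -> zmodule W := fglift (fun p => f p.1 p.2 : zmodule W).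
Definition tensor_lift (x : tensor) : W := g (repr x).

Hypothesis balf : balanced.

Let gB x y : g (x - y) = g x - g y :> W.
Proof. exact: (@lift_is_additive _ _ (zmodule W) _ x y). Qed.

Let gU p : g << p >> = f p.1 p.2.
Proof. by rewrite /g liftU scale1r. Qed.

Let g_null x : x \in tensor_null -> g x = 0.
Proof.
pose K : pred F := fun x => g x == 0.
have Kz : zmod_closed K.
  split=> [|y z /eqP gy /eqP gz]; apply/eqP; last by rewrite gB gy gz subr0.
  by rewrite -(subr0 0) gB subrr.
pose Kcl := GRing.isZmodClosed.Build F K Kz.
pose G : zmodClosed F := HB.pack K Kcl.
move=> /asboolP/(_ G) xG; apply/eqP; apply: xG => y rely.
by apply/eqP; have [fDl fDr fZ] := balf; case: rely => *;
  rewrite !gB !gU /= ?fDl ?fDr ?fZ ?subrr // addrAC addrK subrr.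
Qed.

Lemma tensor_lift_pi x : tensor_lift (tensor_pi x) = g x.
Proof.
apply/eqP; rewrite -subr_eq0 /tensor_lift -gB.
by rewrite g_null // -tensor_pi_eq /tensor_pi reprK.
Qed.

Lemma tensor_liftE v m : tensor_lift (tens v m) = f v m.
Proof. by rewrite /tens tensor_lift_pi gU. Qed.

Lemma tensor_lift_zmod : zmod_morphism tensor_lift.
Proof.
move=> x y; have piK z : tensor_pi (repr z) = z by rewrite /tensor_pi reprK.
by rewrite -(piK x) -(piK y) -raddfB !tensor_lift_pi gB.
Qed.

End Lift.

Lemma tensor_ext (W : zmodType) (f g : tensor -> W) :
    zmod_morphism f -> zmod_morphism g ->
  (forall v m, f (tens v m) = g (tens v m)) -> f =1 g.
Proof.
move=> fB gB fg; elim/tensor_ind => // [|x y fgx fgy].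
  by rewrite -(subrr 0) fB gB !subrr.
by rewrite fB gB fgx fgy.
Qed.

Definition tensor_scale (s : S^c) (x : tensor) : tensor :=
  tensor_lift (fun v m => tens v (s *: m)) x.

Fact tscale_balanced (s : S^c) : balanced (fun v m => tens v (s *: m)).
Proof.
split=> *; first exact: tensDl; first by rewrite scalerDr tensDr.
by rewrite tensZ lactZ.
Qed.

Lemma tensor_scale_tens s v m : tensor_scale s (tens v m) = tens v (s *: m).
Proof. exact: (tensor_liftE (tscale_balanced s)). Qed.

Fact tensor_scaleB s : zmod_morphism (tensor_scale s).
Proof. exact/tensor_lift_zmod/tscale_balanced. Qed.

Fact tensor_scaleA s t x :
  tensor_scale s (tensor_scale t x) = tensor_scale (s * t) x.
Proof.
move: x; apply: tensor_ext => [x y|x y|v m]; rewrite ?tensor_scaleB //.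
by rewrite !tensor_scale_tens scalerA.
Qed.
Fact tensor_scale1 : left_id 1 tensor_scale.
Proof.
apply: tensor_ext => [x y|x y|v m]; rewrite ?tensor_scaleB //.
by rewrite tensor_scale_tens scale1r.
Qed.
Fact tensor_scaleDr : right_distributive tensor_scale +%R.
Proof.
move=> s x y; have s0 : tensor_scale s 0 = 0.
  by rewrite -{1}(subrr 0) tensor_scaleB subrr.
by rewrite -{1}[y]opprK tensor_scaleB -[- y]sub0r tensor_scaleB s0 sub0r opprK.
Qed.
Fact tensor_scaleDl x : {morph tensor_scale^~ x : s t / s + t}.
Proof.
move=> s t; move: x; apply: tensor_ext => [x y|x y|v m] /=.
- exact: tensor_scaleB.
- by rewrite !tensor_scaleB opprD addrACA.
by rewrite !tensor_scale_tens scalerDl tensDr.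
Qed.
HB.instance Definition _ := GRing.Zmodule_isLmodule.Build S^c tensor
  tensor_scaleA tensor_scale1 tensor_scaleDr tensor_scaleDl.

Lemma tensZr s v m : s *: tens v m = tens v (s *: m).
Proof. exact: tensor_scale_tens. Qed.

End Tensor.

Arguments tens {R S V M} v m.

(* f (x) id_M *)
Section TensorMap.
Variables (R S : nzRingType) (V W : lmodType R^c) (M : bimodule R S).
Variable f : {linear V -> W}.

Fact tensor_map_balanced : balanced (fun v (m : M) => tens (f v) m).
Proof.
by split=> *; rewrite ?linearD ?tensDl ?tensDr // linearZ tensZ.
Qed.

Definition tensor_map : tensor V M -> tensor W M :=
  tensor_lift (fun v m => tens (f v) m).

Lemma tensor_mapE v m : tensor_map (tens v m) = tens (f v) m.
Proof. exact: (tensor_liftE tensor_map_balanced). Qed.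

Fact tensor_mapB : zmod_morphism tensor_map.
Proof. exact/tensor_lift_zmod/tensor_map_balanced. Qed.
HB.instance Definition _ :=
  GRing.isZmodMorphism.Build (tensor V M) (tensor W M) tensor_map tensor_mapB.

Fact tensor_mapZ : scalable tensor_map.
Proof.
move=> s; apply: tensor_ext => [x y|x y|v m].
- by rewrite scalerBr raddfB.
- by rewrite raddfB scalerBr.
by rewrite tensor_mapE !tensZr tensor_mapE.
Qed.
HB.instance Definition _ :=
  GRing.isScalable.Build S^c (tensor V M) (tensor W M) *:%R
    tensor_map tensor_mapZ.

End TensorMap.

Lemma tensor_map_id (R S : nzRingType) (V : lmodType R^c) (M : bimodule R S) :
  tensor_map (M := M) (idfun : {linear V -> V}) =1 id.
Proof.
by apply: tensor_ext => [||v m] //; [apply: tensor_mapB | rewrite tensor_mapE].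
Qed.

Lemma tensor_map_comp (R S : nzRingType) (U V W : lmodType R^c)
    (M : bimodule R S) (g : {linear V -> W}) (f : {linear U -> V}) :
  tensor_map (M := M) (g \o f : {linear U -> W}) =1
  tensor_map g \o tensor_map f.
Proof.
apply: tensor_ext => [|x y|v m]; first exact: tensor_mapB.
  by rewrite /= !raddfB.
by rewrite /= !tensor_mapE.
Qed.

Definition bimodule_hom (R S : nzRingType) (M N : bimodule R S)
    (f : {linear M -> N}) : Prop :=
  forall a m, f (lact M a m) = lact N a (f m).

Section RegularBimodule.
Variable R : nzRingType.
Let M : lmodType R^c := (R^c)^o.
Let rlact (a : R) (m : M) : M := (a : R) * (m : R).
Let rlactA a b m : rlact a (rlact b m) = rlact (a * b) m.
Proof. exact: (@mulrA R a b m). Qed.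
Let rlact1 m : rlact 1 m = m. Proof. exact: (@mul1r R m). Qed.
Let rlactDr a m n : rlact a (m + n) = rlact a m + rlact a n.
Proof. exact: (@mulrDr R a m n). Qed.
Let rlactDl a b m : rlact (a + b) m = rlact a m + rlact b m.
Proof. exact: (@mulrDl R a b m). Qed.
Let rlactZ a (s : R^c) m : rlact a (s *: m) = s *: rlact a m.
Proof. exact: (@mulrA R a m s). Qed.

Definition regular_bimodule : bimodule R R :=
  Bimodule rlactA rlact1 rlactDr rlactDl rlactZ.
End RegularBimodule.

(* Every right ideal is projective; right ideals are the submodules of R_R,   *)
(* given here by their inclusion.                                             *)
Definition hereditary (R : nzRingType) : Prop :=
  forall (I : lmodType R^c) (i : {linear I -> (R^c)^o}),
    injective i -> projective I.

Section Separable.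
Variables (k : fieldType) (B : falgType k).

(* The B-B-bimodules on which the two actions of k agree, i.e. the modules    *)
(* over the enveloping algebra of B.                                          *)
Definition k_central (M : bimodule B B) : Prop :=
  forall (c : k) (m : M), lact M c%:A m = (c%:A : B^c) *: m.

(* B is projective as a module over its enveloping algebra. *)
Definition separable_algebra : Prop :=
  forall (M N : bimodule B B) (p : {linear M -> N})
         (f : {linear regular_bimodule B -> N}),
    k_central M -> k_central N -> bimodule_hom p -> bimodule_hom f ->
    (forall y, exists x, p x = y) ->
  exists2 g : {linear regular_bimodule B -> M},
    bimodule_hom g & forall b, p (g b) = f b.

End Separable.

Record category := Category {
  obj :> Type;
  hom : obj -> obj -> Type;
  id_hom : forall x, hom x x;
  comp_hom : forall x y z, hom y z -> hom x y -> hom x z;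
  comp_id_l : forall x y (f : hom x y), comp_hom (id_hom y) f = f;
  comp_id_r : forall x y (f : hom x y), comp_hom f (id_hom x) = f;
  comp_homA : forall x y z t (h : hom z t) (g : hom y z) (f : hom x y),
    comp_hom h (comp_hom g f) = comp_hom (comp_hom h g) f }.

Arguments id_hom {c} x.
Arguments comp_hom {c x y z} g f : rename.

Record functor (C D : category) := Functor {
  fobj :> C -> D;
  fmap : forall x y, hom x y -> hom (fobj x) (fobj y);
  fmap_id : forall x, fmap (id_hom x) = id_hom (fobj x);
  fmap_comp : forall x y z (g : hom y z) (f : hom x y),
    fmap (comp_hom g f) = comp_hom (fmap g) (fmap f) }.

Arguments fmap {C D} f {x y} h : rename.

Definition functor_id (C : category) : functor C C :=
  @Functor C C id (fun _ _ f => f) (fun=> erefl) (fun _ _ _ _ _ => erefl).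

Section FunctorComp.
Variables (C D E : category) (G : functor D E) (F : functor C D).

Fact functor_comp_id x : fmap G (fmap F (id_hom x)) = id_hom (G (F x)).
Proof. by rewrite !fmap_id. Qed.
Fact functor_comp_comp x y z (g : hom y z) (f : hom x y) :
  fmap G (fmap F (comp_hom g f)) =
  comp_hom (fmap G (fmap F g)) (fmap G (fmap F f)).
Proof. by rewrite !fmap_comp. Qed.

Definition functor_comp : functor C E :=
  @Functor C E (fun x => G (F x)) (fun x y f => fmap G (fmap F f))
    functor_comp_id functor_comp_comp.
End FunctorComp.

Definition naturally_isomorphic (C D : category) (F G : functor C D) : Prop :=
  exists (eta : forall x, hom (F x) (G x)) (theta : forall x, hom (G x) (F x)),
  [/\ forall x y (f : hom x y),
        comp_hom (eta y) (fmap F f) = comp_hom (fmap G f) (eta x),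
      forall x, comp_hom (theta x) (eta x) = id_hom (F x)
    & forall x, comp_hom (eta x) (theta x) = id_hom (G x)].

Definition equivalent_categories (C D : category) : Prop :=
  exists (F : functor C D) (G : functor D C),
    naturally_isomorphic (functor_comp G F) (functor_id C) /\
    naturally_isomorphic (functor_comp F G) (functor_id D).

Definition full_subcategory (C : category) (P : C -> Prop) : category :=
  @Category {x : C | P x} (fun x y => hom (sval x) (sval y))
    (fun x => id_hom (sval x)) (fun _ _ _ g f => comp_hom g f)
    (fun _ _ f => comp_id_l f) (fun _ _ f => comp_id_r f)
    (fun _ _ _ _ h g f => comp_homA h g f).

Section ModuleCategories.
Variable R : nzRingType.

Definition Mod : category.
Proof.
refine (@Category (lmodType R^c) (fun V W => {linear V -> W})
  (fun V => idfun) (fun U V W g f => (g \o f : {linear U -> W})) _ _ _).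
- by move=> V W f; apply: linear_eq.
- by move=> V W f; apply: linear_eq.
- by move=> U V W X h g f; apply: linear_eq.
Defined.

Definition mod : category := @full_subcategory Mod (@fin_gen R^c).

End ModuleCategories.

(* The valuation of an arrow i -> j is the pair (d_ij, d_ji). *)
Record pv_quiver (s : nat) := PVQuiver {
  arrow : rel 'I_s;
  valuation : forall i j, arrow i j -> nat * nat }.

Record pseudo_modulation (s : nat) (Q : pv_quiver s) := PseudoModulation {
  pm_ring : 'I_s -> nzRingType;
  pm_bimod : forall i j, bimodule (pm_ring i) (pm_ring j);
  pm_arrow : forall i j, arrow Q i j <-> exists m : pm_bimod i j, m != 0;
  pm_valuation : forall i j (e : arrow Q i j),
    valuation e = (rank (pm_bimod i j), rank (bim_left (pm_bimod i j))) }.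

Section Representations.
Variables (s : nat) (Q : pv_quiver s) (M : pseudo_modulation Q).

Record representation := Representation {
  rep_mod : forall i, lmodType (pm_ring M i)^c;
  rep_map : forall i j, arrow Q i j ->
    {linear tensor (rep_mod i) (pm_bimod M i j) -> rep_mod j} }.

Record rep_hom (X Y : representation) := RepHom {
  rep_hom_at : forall i, {linear rep_mod X i -> rep_mod Y i};
  rep_hom_comm : forall i j (e : arrow Q i j) t,
    rep_hom_at j (rep_map X e t) = rep_map Y e (tensor_map (rep_hom_at i) t) }.

Lemma rep_hom_eq X Y (f g : rep_hom X Y) :
  (forall i, rep_hom_at f i =1 rep_hom_at g i) -> f = g.
Proof.
case: f g => [f fc] [g gc] /= fg.
have E : f = g.
  by apply: functional_extensionality_dep => i; exact: linear_eq (fg i).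
by move: gc; rewrite -E => gc; rewrite (Prop_irrelevance fc gc).
Qed.

Definition rep_id X : rep_hom X X.
Proof.
refine (@RepHom X X (fun i => idfun) _) => i j e t.
by rewrite tensor_map_id.
Defined.

Definition rep_comp X Y Z (g : rep_hom Y Z) (f : rep_hom X Y) : rep_hom X Z.
Proof.
refine (@RepHom X Z (fun i => rep_hom_at g i \o rep_hom_at f i) _) => i j e t.
by rewrite tensor_map_comp /= !rep_hom_comm.
Defined.

Definition Rep : category.
Proof.
refine (@Category representation rep_hom rep_id rep_comp _ _ _).
- by move=> X Y f; apply: rep_hom_eq.
- by move=> X Y f; apply: rep_hom_eq.
- by move=> X Y Z T h g f; apply: rep_hom_eq.
Defined.

Definition rep : category :=
  @full_subcategory Rep (fun X => forall i, fin_gen (rep_mod X i)).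

End Representations.

Section RelatedModulation.
Variables (k : fieldType) (A : falgType k).

Local Notation r := (radical A).
Local Notation Abar := (semitop A).

(* r / r^2 *)
Definition rad_layer : Type :=
  vquot (linfun (vsval : subvs_of r -> A) @^-1: (r * r))%VS.
HB.instance Definition _ := Vector.on rad_layer.

Definition rad_layer_pi (x : subvs_of r) : rad_layer := vpi _ x.
Fact rad_layer_pi_linear : linear rad_layer_pi. Proof. exact: linearP. Qed.
HB.instance Definition _ := GRing.isLinear.Build k (subvs_of r) rad_layer *:%R
  rad_layer_pi rad_layer_pi_linear.

Lemma rad_layer_pi_eq x y :
  (rad_layer_pi x == rad_layer_pi y) = (vsval x - vsval y \in (r * r)%VS).
Proof. by rewrite [LHS]vpi_eq -memv_preim lfunE. Qed.

Lemma rad_layer_piK (m : rad_layer) : rad_layer_pi (repr m) = m.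
Proof. exact: vpiK. Qed.

Definition radl (a : A) (x : subvs_of r) : subvs_of r :=
  Subvs (radicalMl a (subvsP x)).
Definition radr (x : subvs_of r) (a : A) : subvs_of r :=
  Subvs (radicalMr a (subvsP x)).

(* The actions of A / r on r / r^2, by representatives; layer_ract b m is     *)
(* m . b.                                                                     *)
Definition layer_lact (a : Abar) (m : rad_layer) : rad_layer :=
  rad_layer_pi (radl (repr a) (repr m)).
Definition layer_ract (a : Abar) (m : rad_layer) : rad_layer :=
  rad_layer_pi (radr (repr m) (repr a)).

Lemma layer_repr x : vsval (repr (rad_layer_pi x)) - vsval x \in (r * r)%VS.
Proof. by rewrite -rad_layer_pi_eq rad_layer_piK. Qed.

Lemma radsqMl (a x : A) : x \in (r * r)%VS -> a * x \in (r * r)%VS.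
Proof.
move=> xrr; rewrite -[a * x](lfunE (a \*o idfun)) memv_preim.
apply: subvP xrr; apply/prodvP => y z yr zr.
by rewrite -memv_preim lfunE /= mulrA memv_mul ?radicalMl.
Qed.
Lemma radsqMr (a x : A) : x \in (r * r)%VS -> x * a \in (r * r)%VS.
Proof.
move=> xrr; rewrite -[x * a](lfunE (a \o* idfun)) memv_preim.
apply: subvP xrr; apply/prodvP => y z yr zr.
by rewrite -memv_preim lfunE /= -mulrA memv_mul ?radicalMr.
Qed.

Lemma layer_lactE a x :
  layer_lact (semitop_pi a) (rad_layer_pi x) = rad_layer_pi (radl a x).
Proof.
apply/eqP; rewrite rad_layer_pi_eq /=.
set a' := repr _; set x' := vsval (repr _).
rewrite -[a'](subrK a) mulrDl -addrA memvD //.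
  by rewrite memv_mul ?subvsP // repr_vpi.
by rewrite -mulrBr radsqMl ?layer_repr.
Qed.
Lemma layer_ractE a x :
  layer_ract (semitop_pi a) (rad_layer_pi x) = rad_layer_pi (radr x a).
Proof.
apply/eqP; rewrite rad_layer_pi_eq /=.
set a' := repr (semitop_pi a); set x' := vsval (repr _).
rewrite -[a'](subrK a) mulrDr -addrA memvD //.
  by rewrite memv_mul ?subvsP // repr_vpi.
by rewrite -mulrBl radsqMr ?layer_repr.
Qed.

Lemma layer_lactA a b m : layer_lact a (layer_lact b m) = layer_lact (a * b) m.
Proof.
rewrite -(semitop_piK a) -(semitop_piK b) -(rad_layer_piK m).
rewrite -rmorphM !layer_lactE.
by congr rad_layer_pi; apply: val_inj; rewrite /= mulrA.
Qed.
Lemma layer_ractA a b m : layer_ract b (layer_ract a m) = layer_ract (a * b) m.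
Proof.
rewrite -(semitop_piK a) -(semitop_piK b) -(rad_layer_piK m).
rewrite -rmorphM !layer_ractE.
by congr rad_layer_pi; apply: val_inj; rewrite /= mulrA.
Qed.
Lemma layer_lractA a b m :
  layer_lact a (layer_ract b m) = layer_ract b (layer_lact a m).
Proof.
rewrite -(semitop_piK a) -(semitop_piK b) -(rad_layer_piK m).
rewrite layer_ractE !layer_lactE layer_ractE.
by congr rad_layer_pi; apply: val_inj; rewrite /= mulrA.
Qed.
Lemma layer_lactP a : linear (layer_lact a).
Proof.
move=> c m n; rewrite -(semitop_piK a) -(rad_layer_piK m) -(rad_layer_piK n).
rewrite -linearP !layer_lactE -linearP.
by congr rad_layer_pi; apply: val_inj; rewrite /= mulrDr -scalerAr.
Qed.
Lemma layer_ractP a : linear (layer_ract a).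
Proof.
move=> c m n; rewrite -(semitop_piK a) -(rad_layer_piK m) -(rad_layer_piK n).
rewrite -linearP !layer_ractE -linearP.
by congr rad_layer_pi; apply: val_inj; rewrite /= mulrDl -scalerAl.
Qed.
Lemma layer_lactDl m : {morph layer_lact^~ m : a b / a + b}.
Proof.
move=> a b; rewrite -(semitop_piK a) -(semitop_piK b) -(rad_layer_piK m).
rewrite -raddfD !layer_lactE -raddfD.
by congr rad_layer_pi; apply: val_inj; rewrite /= mulrDl.
Qed.
Lemma layer_ractDl m : {morph layer_ract^~ m : a b / a + b}.
Proof.
move=> a b; rewrite -(semitop_piK a) -(semitop_piK b) -(rad_layer_piK m).
rewrite -raddfD !layer_ractE -raddfD.
by congr rad_layer_pi; apply: val_inj; rewrite /= mulrDr.
Qed.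

HB.instance Definition _ a := GRing.isLinear.Build k rad_layer rad_layer *:%R
  (layer_lact a) (layer_lactP a).
HB.instance Definition _ a := GRing.isLinear.Build k rad_layer rad_layer *:%R
  (layer_ract a) (layer_ractP a).

(* The span A_i . (r / r^2) . A_j of the products a . m . b. *)
Section Arrow.
Variables (Ai Aj : {aspace Abar}).

Definition arrow_space : {vspace rad_layer} :=
  vinter (fun W => forall a m b, a \in Ai -> b \in Aj ->
                     layer_ract b (layer_lact a m) \in W).

Lemma arrow_space_gen a m b :
  a \in Ai -> b \in Aj -> layer_ract b (layer_lact a m) \in arrow_space.
Proof. by move=> ai bj; apply/vinterP => W; apply. Qed.

Lemma arrow_space_sub (W : {vspace rad_layer}) :
    (forall a m b, a \in Ai -> b \in Aj ->
       layer_ract b (layer_lact a m) \in W) ->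
  {subset arrow_space <= W}.
Proof. by move=> genW x /vinterP; apply. Qed.

Lemma arrow_spaceMl a m :
  a \in Ai -> m \in arrow_space -> layer_lact a m \in arrow_space.
Proof.
move=> ai; rewrite -[layer_lact a m](lfunE (layer_lact a)) memv_preim.
apply: arrow_space_sub => a' n b a'i bj; rewrite -memv_preim lfunE /=.
by rewrite layer_lractA layer_lactA arrow_space_gen // memvM.
Qed.

Lemma arrow_spaceMr m b :
  m \in arrow_space -> b \in Aj -> layer_ract b m \in arrow_space.
Proof.
move=> mM bj; move: m mM => m; rewrite -[layer_ract b m](lfunE (layer_ract b)).
rewrite memv_preim; apply: arrow_space_sub => a n b' ai b'j.
by rewrite -memv_preim lfunE /= layer_ractA arrow_space_gen // memvM.
Qed.

Lemma arrow_space1l m : m \in arrow_space -> layer_lact (algid Ai) m = m.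
Proof.
move=> mM; apply/eqP; rewrite -subr_eq0.
suff: m \in lker (linfun (layer_lact (algid Ai)) - \1)%VF.
  by rewrite memv_ker add_lfunE opp_lfunE id_lfunE lfunE.
move: m mM; apply: arrow_space_sub => a m b ai bj.
rewrite memv_ker add_lfunE opp_lfunE id_lfunE lfunE subr_eq0 /=.
rewrite layer_lractA layer_lactA.
by rewrite algidl.
Qed.
Lemma arrow_space1r m : m \in arrow_space -> layer_ract (algid Aj) m = m.
Proof.
move=> mM; apply/eqP; rewrite -subr_eq0.
suff: m \in lker (linfun (layer_ract (algid Aj)) - \1)%VF.
  by rewrite memv_ker add_lfunE opp_lfunE id_lfunE lfunE.
move: m mM; apply: arrow_space_sub => a m b ai bj.
rewrite memv_ker add_lfunE opp_lfunE id_lfunE lfunE subr_eq0 /= layer_ractA.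
by rewrite algidr.
Qed.

Definition arrow_mod : Type := subvs_of arrow_space.
HB.instance Definition _ := GRing.Zmodule.on arrow_mod.

Implicit Types (m n : arrow_mod).

Definition arrow_ract (b : (subvs_of Aj)^c) m : arrow_mod :=
  Subvs (arrow_spaceMr (subvsP m) (subvsP b)).
Definition arrow_lact (a : subvs_of Ai) m : arrow_mod :=
  Subvs (arrow_spaceMl (subvsP a) (subvsP m)).

Fact arrow_ractA a b m : arrow_ract a (arrow_ract b m) = arrow_ract (a * b) m.
Proof. by apply: val_inj; apply: layer_ractA. Qed.
Fact arrow_ract1 : left_id 1 arrow_ract.
Proof. by move=> m; apply: val_inj; apply: arrow_space1r (subvsP m). Qed.
Fact arrow_ractDr : right_distributive arrow_ract +%R.
Proof.
move=> a m n; apply: val_inj.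
exact: (raddfD (layer_ract (vsval a)) (vsval m) (vsval n)).
Qed.
Fact arrow_ractDl m : {morph arrow_ract^~ m : a b / a + b}.
Proof.
move=> a b; apply: val_inj.
exact: (layer_ractDl (vsval m) (vsval (a : subvs_of Aj))
         (vsval (b : subvs_of Aj))).
Qed.
HB.instance Definition _ := GRing.Zmodule_isLmodule.Build (subvs_of Aj)^c
  arrow_mod arrow_ractA arrow_ract1 arrow_ractDr arrow_ractDl.

Fact arrow_lactA a b m : arrow_lact a (arrow_lact b m) = arrow_lact (a * b) m.
Proof. by apply: val_inj; apply: layer_lactA. Qed.
Fact arrow_lact1 m : arrow_lact 1 m = m.
Proof. by apply: val_inj; apply: arrow_space1l (subvsP m). Qed.
Fact arrow_lactDr a m n :
  arrow_lact a (m + n) = arrow_lact a m + arrow_lact a n.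
Proof.
apply: val_inj.
exact: (raddfD (layer_lact (vsval a)) (vsval m) (vsval n)).
Qed.
Fact arrow_lactDl a b m :
  arrow_lact (a + b) m = arrow_lact a m + arrow_lact b m.
Proof.
by apply: val_inj; exact: (layer_lactDl (vsval m) (vsval a) (vsval b)).
Qed.
Fact arrow_lactZ a (b : (subvs_of Aj)^c) m :
  arrow_lact a (b *: m) = b *: arrow_lact a m.
Proof. by apply: val_inj; apply: layer_lractA. Qed.

Definition arrow_bimodule : bimodule (subvs_of Ai) (subvs_of Aj) :=
  Bimodule arrow_lactA arrow_lact1 arrow_lactDr arrow_lactDl arrow_lactZ.

End Arrow.

Variables (s : nat) (E : 'I_s -> {aspace Abar}).

(* The E i are the simple two-sided ideals of A / r. That E i is an {aspace}  *)
(* only asks it to have an identity, which every direct factor of A / r has.  *)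
Definition simple_decomposition : Prop :=
  [/\ forall i, simple_ideal (E i), directv (\sum_i E i)%VS
    & (\sum_i E i)%VS = fullv].

Definition related_quiver : pv_quiver s :=
  @PVQuiver s (fun i j => arrow_space (E i) (E j) != 0%VS)
    (fun i j _ => (rank (arrow_bimodule (E i) (E j)),
                   rank (bim_left (arrow_bimodule (E i) (E j))))).

Fact related_arrow i j :
  arrow related_quiver i j <-> exists m : arrow_bimodule (E i) (E j), m != 0.
Proof.
split=> [|[m]]; last first.
  apply: contraNneq => M0; apply/eqP/val_inj/eqP; rewrite /= -memv0 -M0.
  exact: subvsP.
move=> M0; exists (Subvs (memv_pick (arrow_space (E i) (E j)))).
by apply: contraNneq M0 => /(congr1 val) /= /eqP; rewrite vpick0.
Qed.

Definition related_modulation : pseudo_modulation related_quiver :=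
  @PseudoModulation s related_quiver (fun i => subvs_of (E i))
    (fun i j => arrow_bimodule (E i) (E j)) related_arrow (fun _ _ _ => erefl).

End RelatedModulation.

(* Main.v *)
Require Import Defs.
From HB Require Import structures.
From mathcomp Require Import all_boot all_order all_algebra all_field.
From mathcomp Require Import boolp.
Import Defs.

(* Write r for the radical of A, B = A/r and M = r/r^2. Averaging against a   *)
(* separability idempotent of B lifts B to a subalgebra of A and M to a       *)
(* sub-B-bimodule of r. Since r is a projective right module with top M, the  *)
(* multiplication M (x)_B A -> r is an isomorphism of right A-modules, and r  *)
(* is nilpotent, so that A is the tensor algebra of M over B. Concretely,     *)
(* every a in A is b + sum_i m_i psi_i(a) for fixed m_i in M and coordinates  *)
(* psi_i whose long enough iterates vanish, and v.a = v.b + sum_i             *)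
(* phi(v, m_i).psi_i(a) extends every B-module V with a map                   *)
(* phi : V (x)_B M -> V to an A-module in a unique way. Splitting V along the *)
(* central idempotents of B turns such pairs (V, phi) into representations.   *)

Set Implicit Arguments.
Unset Strict Implicit.
Unset Printing Implicit Defensive.

Import GRing.Theory.
Local Open Scope ring_scope.

(** * Separability *)

(** The heart of the matter is that A is the tensor algebra of M = r / r^2 over B = A / r. A right
    A-module is then the same thing as a right B-module V with a B-linear map V (x)_B M -> V, and
    cutting V by the central idempotents of B turns this pair into a representation.

    Separability enters only through [separability_idempotent]. Averaging against it gives an
    algebra section B -> A ([wedderburn_section]), a bimodule section M -> r ([layer_section]) and a
    finite dual basis of M as a right B-module ([layer_dual_basis]). Heredity enters only in
    [rad_coordinates]: r is a projective right module, so the surjection A^n -> r given by the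
    lifted generators splits, and comparison with M (x)_B A shows that M (x)_B A -> r is bijective.
    Nilpotency of r makes the resulting coordinates vanish after boundedly many steps
    ([psi_vanishes]). The record [tensor_presentation] collects this data, and everything after it
    depends on the data alone.

    The functor sends an A-module N to its corners at the idempotents of B. It is full because A is
    generated by the images of B and M ([glue_rmul]), and every representation is reached because
    its total space extends to an A-module ([ext_actA], [total_rep_iso]). [equivalence_criterion]
    then gives the equivalence, and [corner_fin_gen] restricts it to finitely generated objects. *)

Section EnvelopingBimodule.
Variables (k : fieldType) (B : falgType k).

Local Notation n := (\dim {:B}).
Local Notation e i := (vbasis {:B})`_i.
Local Notation cd i b := (coord (vbasis {:B}) i b).
Local Notation T := {ffun 'I_n -> (B^c)^o}.

Let eE (b : B) : b = \sum_(i < n) cd i b *: e i.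
Proof. exact: (coord_vbasis (memvf b)). Qed.

(* The element [\sum_i e i (x) y i] of the tensor square of B is encoded as   *)
(* the function y; env_coef b y encodes its left multiple by b.               *)
Definition env_coef (b : B) (y : 'I_n -> B) (j : 'I_n) : B :=
  \sum_(i < n) cd j (b * e i) *: y i.

Lemma env_coefA a b y : env_coef a (env_coef b y) =1 env_coef (a * b) y.
Proof.
move=> j; rewrite /env_coef; under eq_bigr => i _ do rewrite scaler_sumr.
rewrite exchange_big; apply: eq_bigr => i _ /=.
under eq_bigr => l _ do rewrite scalerA.
rewrite -scaler_suml; congr (_ *: _).
rewrite -mulrA [b * e i in RHS]eE mulr_sumr linear_sum.
by apply: eq_bigr => l _ /=; rewrite -scalerAr linearZ mulrC.
Qed.

Lemma env_coef1 y : env_coef 1 y =1 y.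
Proof.
move=> j; rewrite /env_coef (bigD1 j) //= big1 => [|i nij].
  by rewrite mul1r coord_free ?(basis_free (vbasisP _)) // eqxx scale1r addr0.
rewrite mul1r coord_free ?(basis_free (vbasisP _)) //.
by rewrite (negPf nij) scale0r.
Qed.

Lemma env_coefMr a y b j :
  env_coef a (fun i => y i * b) j = env_coef a y j * b.
Proof.
by rewrite /env_coef mulr_suml; apply: eq_bigr => i _; rewrite scalerAl.
Qed.

Lemma env_coefDr a y z j :
  env_coef a (fun i => y i + z i) j = env_coef a y j + env_coef a z j.
Proof. by rewrite -big_split; apply: eq_bigr => i _; rewrite scalerDr. Qed.

Lemma env_coefDl a b y j :
  env_coef (a + b) y j = env_coef a y j + env_coef b y j.
Proof.
rewrite -big_split; apply: eq_bigr => i _ /=.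
by rewrite mulrDl linearD scalerDl.
Qed.

Lemma env_coef_scalar c y j : env_coef c%:A y j = y j * c%:A.
Proof.
rewrite mulr_algr -[y j in RHS]env_coef1 /env_coef scaler_sumr.
by apply: eq_bigr => i _; rewrite mul1r mulr_algl linearZ scalerA.
Qed.

Lemma mulr_env_coef a y :
  \sum_(j < n) e j * env_coef a y j = a * \sum_(j < n) e j * y j.
Proof.
rewrite mulr_sumr; under eq_bigr => j _ do rewrite mulr_sumr.
rewrite exchange_big; apply: eq_bigr => i _ /=.
under eq_bigr => j _ do rewrite -scalerAr scalerAl.
by rewrite -mulr_suml mulrA -eE.
Qed.

Definition env_lact (b : B) (y : T) : T := [ffun j => env_coef b y j].

Fact env_lactA a b y : env_lact a (env_lact b y) = env_lact (a * b) y.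
Proof.
apply/ffunP=> j; rewrite ffunE -[RHS]/(env_lact (a * b) y j) ffunE -env_coefA.
by apply: eq_bigr => i _; rewrite ffunE.
Qed.
Fact env_lact1 y : env_lact 1 y = y.
Proof. by apply/ffunP=> j; rewrite ffunE; apply: env_coef1. Qed.
Fact env_lactDr a y z : env_lact a (y + z) = env_lact a y + env_lact a z.
Proof.
apply/ffunP=> j; rewrite ffunE [RHS]ffunE ![env_lact _ _ _]ffunE.
rewrite -[RHS](env_coefDr a y z j).
by apply: eq_bigr => i _; rewrite ffunE.
Qed.
Fact env_lactDl a b y : env_lact (a + b) y = env_lact a y + env_lact b y.
Proof.
apply/ffunP=> j; rewrite ffunE [RHS]ffunE ![env_lact _ _ _]ffunE.
exact: env_coefDl.
Qed.
Fact env_lactZ a (b : B^c) y : env_lact a (b *: y) = b *: env_lact a y.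
Proof.
apply/ffunP=> j; rewrite ffunE [RHS]ffunE [env_lact _ _ _]ffunE.
rewrite -[RHS](env_coefMr a y (b : B) j).
by apply: eq_bigr => i _; rewrite ffunE.
Qed.

Definition env_bimodule : bimodule B B :=
  Bimodule env_lactA env_lact1 env_lactDr env_lactDl env_lactZ.

Lemma env_k_central : k_central env_bimodule.
Proof.
move=> c y; apply/ffunP=> j; rewrite ffunE [RHS]ffunE.
exact: (env_coef_scalar c y j).
Qed.

(** The multiplication B (x)_k B -> B in coordinates. A splitting of it by a bimodule map is what
    separability provides. *)
Definition env_mul (y : env_bimodule) : regular_bimodule B :=
  \sum_(i < n) e i * (y i : B).

Fact env_mul_linear : linear env_mul.
Proof.
move=> b y z.
rewrite -[RHS]/((\sum_(i < n) e i * (y i : B)) * (b : B)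
                 + \sum_(i < n) e i * (z i : B)).
rewrite mulr_suml -big_split; apply: eq_bigr => i _ /=.
by rewrite !ffunE mulrDr -mulrA.
Qed.
HB.instance Definition _ := GRing.isLinear.Build B^c env_bimodule
  (regular_bimodule B) *:%R env_mul env_mul_linear.

Lemma env_mul_bimodule_hom : bimodule_hom env_mul.
Proof.
move=> a y; rewrite -[RHS](mulr_env_coef a y).
by apply: eq_bigr => i _; rewrite ffunE.
Qed.

(* A separability idempotent [\sum_i x i (x) y i]: since F is bilinear, the   *)
(* last equation says that it commutes with every b.                          *)
Lemma separability_idempotent :
    separable_algebra B ->
  exists (m : nat) (x y : 'I_m -> B), \sum_i x i * y i = 1 /\
    forall (W : lmodType k) (F : B -> B -> W) (b : B),
      (forall v, linear (F^~ v)) -> (forall u, linear (F u)) ->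
    \sum_i F (b * x i) (y i) = \sum_i F (x i) (y i * b).
Proof.
move=> sepB.
have central_reg : k_central (regular_bimodule B).
  by move=> c m;
     exact: (etrans (mulr_algl c (m : B)) (esym (mulr_algr c (m : B)))).
(* The preimage is 1 (x) y, with 1 expanded in the basis. *)
have surj_mul y : exists x, env_mul x = y.
  exists [ffun i => cd i 1 *: (y : B)].
  rewrite /env_mul -[RHS](mul1r (y : B)) [in RHS](eE 1) mulr_suml.
  by apply: eq_bigr => i _; rewrite ffunE -scalerAr -scalerAl.
have [g gM gK] := sepB _ _ env_mul (idfun : {linear regular_bimodule B -> _})
  env_k_central central_reg env_mul_bimodule_hom (fun _ _ => erefl) surj_mul.
pose y : T := g (1 : B); exists n, (fun i => e i), y; split; first exact: gK.
move=> W F b Fl Fr.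
pose lF v : {linear B -> W} := HB.pack (F^~ v)
  (GRing.isLinear.Build k B W *:%R (F^~ v) (Fl v)).
pose rF u : {linear B -> W} := HB.pack (F u)
  (GRing.isLinear.Build k B W *:%R (F u) (Fr u)).
(* As [g] is a bimodule map, b . g(1) = g(b) = g(1) . b. *)
have yb j : env_coef b y j = (y j : B) * b.
  have : lact env_bimodule b y = ((b : B^c) *: y : env_bimodule).
    rewrite /y -gM -linearZ; congr (g _).
    exact: (etrans (mulr1 b) (esym (mul1r b))).
  by move=> /ffunP/(_ j); rewrite ffunE => ->; rewrite ffunE.
have Fsuml v (c : 'I_n -> k) (z : 'I_n -> B) :
    F (\sum_i c i *: z i) v = \sum_i c i *: F (z i) v.
  rewrite -[LHS]/(lF v _) linear_sum.
  by apply: eq_bigr => i _; rewrite linearZ.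
have Fsumr u (c : 'I_n -> k) (z : 'I_n -> B) :
    F u (\sum_i c i *: z i) = \sum_i c i *: F u (z i).
  rewrite -[LHS]/(rF u _) linear_sum.
  by apply: eq_bigr => i _; rewrite linearZ.
under [RHS]eq_bigr => j _ do rewrite -yb Fsumr.
rewrite exchange_big; apply: eq_bigr => i _ /=.
by rewrite [b * e i in LHS]eE Fsuml.
Qed.

End EnvelopingBimodule.

(** * The radical and the Wedderburn section *)

Section Radical.
Variables (k : fieldType) (A : falgType k).
Implicit Types (U W X : {vspace A}) (a x y : A).

Local Notation r := (radical A).

(** A form of Nakayama's lemma. Take a maximal proper right subideal Y of X. For x in X outside Y,
    the elements a with x a in Y form a maximal right ideal, hence contain r; thus X r lies in Y. *)
Lemma mul_radical_proper X : right_ideal X -> X != 0%VS -> (X * r)%VS != X.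
Proof.
move=> /right_idealP RX X0.
pose Q n := `[< exists U,
  [/\ right_ideal U, (U <= X)%VS, U != X & \dim U = n] >].
have exQ : exists n, Q n.
  exists 0%N; apply/asboolP; exists 0%VS; rewrite dimv0 eq_sym sub0v.
  by split=> //; rewrite /right_ideal prod0v sub0v.
have ubQ n : Q n -> (n <= dim A)%N.
  by move=> /asboolP[U [_ _ _ <-]]; rewrite -dimvf dimvS ?subvf.
have [n /asboolP[Y [/right_idealP RY sYX nYX <-]] max_n] := ex_maxnP exQ ubQ.
suff sub : (X * r <= Y)%VS.
  by apply: contraNneq nYX => XrX; rewrite eqEsubv sYX -{1}XrX.
apply/prodvP=> x a xX.
have [xY _|xY] := boolP (x \in Y); first exact: RY.
pose V := (amull x @^-1: Y)%VS.
have memV z : (z \in V) = (x * z \in Y) by rewrite -memv_preim !lfunE.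
rewrite -memV => /vinterP; apply; split.
- by apply/right_idealP=> z; rewrite memV => zV t; rewrite memV mulrA RY.
- by apply: contraNneq xY => VA; rewrite -[x]mulr1 -memV VA memvf.
move=> W /right_idealP RW sVW.
have [|nWV] := eqVneq W V; [by left | right].
have [z zW zY] : exists2 z, z \in W & x * z \notin Y.
  apply: contrapT => nex; case/eqP: nWV; apply/eqP; rewrite eqEsubv sVW andbT.
  apply/subvP=> z zW; rewrite memV; apply: contrapT => /negP zY.
  by apply: nex; exists z.
have memI t : t \in W -> x * t \in (amull x @: W)%VS.
  by move=> tW; rewrite -[x * t](lfunE (x \*o idfun)) memv_img.
pose Z := (Y + amull x @: W)%VS.
have ZX : Z = X.
  have sZX : (Z <= X)%VS.
    apply/subvP=> _ /memv_addP[u uY [_ /memv_imgP[w _ ->] ->]].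
    by rewrite lfunE /= rpredD ?RX // (subvP sYX).
  apply: contrapT => /eqP nZX; have : Q (\dim Z).
    apply/asboolP; exists Z; split=> //; apply/right_idealP.
    move=> _ /memv_addP[u uY [_ /memv_imgP[w wW ->] ->]] t.
    by rewrite mulrDl memv_add ?RY // !lfunE /= -mulrA memI ?RW.
  move=> /max_n leZY; case/negP: zY.
  have /eqP -> : Y == Z by rewrite eqEdim addvSl.
  by rewrite -[_ * z]add0r memv_add ?mem0v ?memI.
have : x \in Z by rewrite ZX.
case/memv_addP=> u uY [_ /memv_imgP[w wW ->]]; rewrite !lfunE /= => xE.
have : 1 - w \in V by rewrite memV mulrBr mulr1 {1}xE addrK.
move=> /(subvP sVW) /(rpredD wW); rewrite addrC subrK => W1.
by apply/vspaceP=> v; rewrite memvf -[v]mul1r RW.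
Qed.

Lemma radXMr n x a : x \in (r ^+ n.+1)%VS -> x * a \in (r ^+ n.+1)%VS.
Proof.
rewrite -[x * a](lfunE (a \o* idfun)) memv_preim expvSr => xr.
apply: subvP xr; apply/prodvP => y z yr zr.
by rewrite -memv_preim lfunE /= -mulrA memv_mul ?radicalMr.
Qed.

Lemma radXMl n x a : x \in (r ^+ n.+1)%VS -> a * x \in (r ^+ n.+1)%VS.
Proof.
rewrite -[a * x](lfunE (a \*o idfun)) memv_preim expvSl => xr.
apply: subvP xr; apply/prodvP => y z yr zr.
by rewrite -memv_preim lfunE /= mulrA memv_mul ?radicalMl.
Qed.

Lemma radX_sub n : (r ^+ n.+1 <= r)%VS.
Proof.
rewrite expvSl; case: n => [|n]; first by rewrite expv0 prodv1.
by apply/prodvP=> x y xr _; apply: radicalMr.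
Qed.

Lemma radX_subS n : (r ^+ n.+2 <= r ^+ n.+1)%VS.
Proof. by rewrite expvSr; apply/prodvP=> x y xr _; apply: radXMr. Qed.

(** By [mul_radical_proper] the dimensions of the powers of r drop strictly until they reach 0. *)
Lemma radical_nilpotent : exists n, (r ^+ n.+1 = 0)%VS.
Proof.
suff H d n : (\dim (r ^+ n.+1) <= d)%N -> exists m, (r ^+ m.+1 = 0)%VS.
  exact: (H _ 0%N (leqnn _)).
elim: d n => [|d IHd] n led.
  by exists n; apply/eqP; rewrite -dimv_eq0 -leqn0.
have [r0|r0] := eqVneq (r ^+ n.+1)%VS 0%VS; first by exists n.
apply: (IHd n.+1); rewrite -ltnS; apply: leq_trans led.
rewrite ltn_neqAle dimvS ?radX_subS // andbT.
apply: contraTneq (@mul_radical_proper (r ^+ n.+1)%VS _ r0) => [E|].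
  by rewrite negbK -expvSr eqEdim radX_subS E leqnn.
by apply/right_idealP=> x xr y; apply: radXMr.
Qed.

Lemma semitop_pi_eq0 a : (semitop_pi a == 0) = (a \in r).
Proof. exact: vpi_eq0. Qed.

End Radical.

Lemma linear_section (k : fieldType) (V W : vectType k) (p : {linear V -> W}) :
  (forall w, exists v, p v = w) -> exists s : {linear W -> V}, cancel s p.
Proof.
move=> psurj; exists ((linfun p)^-1)%VF => w; rewrite -(lfunE p).
apply: limg_lfunVK; have [v <-] := psurj w.
by rewrite -(lfunE p) memv_img ?memvf.
Qed.

Section WedderburnSection.
Variables (k : fieldType) (A : falgType k).
Hypothesis sepA : separable_algebra (semitop A).

Local Notation r := (radical A).
Local Notation B := (semitop A).

(* The defect [s (x * y) - s x * s y] of a linear section is a Hochschild     *)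
(* 2-cocycle modulo the next power of the radical, and the separability       *)
(* idempotent exhibits it as the coboundary of the correction [h].            *)
Lemma approx_section n : exists s : {linear B -> A},
  cancel s (@semitop_pi k A) /\
  forall x y, s (x * y) - s x * s y \in (r ^+ n.+1)%VS.
Proof.
have [m [e [f [ef1 sep]]]] := separability_idempotent sepA.
elim: n => [|n [s [sK sM]]].
  have [s sK] := @linear_section _ _ _ (@semitop_pi k A)
    (fun b => ex_intro _ (repr b) (semitop_piK b)).
  exists s; split=> // x y.
  by rewrite -semitop_pi_eq0 raddfB /= rmorphM /= !sK subrr.
pose c x y := s (x * y) - s x * s y.
pose h x := \sum_i s (e i) * c (f i) x.
have hr x : h x \in (r ^+ n.+1)%VS by apply: rpred_sum => i _; apply/radXMl/sM.
have cDr u : linear (c u).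
  move=> a x y; rewrite /c mulrDr -scalerAr !linearP mulrDr -scalerAr.
  by rewrite opprD addrACA -scalerBr.
have cDl v : linear (c^~ v).
  move=> a x y; rewrite /c mulrDl -scalerAl !linearP mulrDl -scalerAl.
  by rewrite opprD addrACA -scalerBr.
have hl : linear h.
  move=> a x y; rewrite /h scaler_sumr -big_split; apply: eq_bigr => i _ /=.
  by rewrite cDr mulrDr -scalerAr.
pose hL : {linear B -> A} := HB.pack h (GRing.isLinear.Build k B A *:%R h hl).
have coc x y z : c x y * s z = s x * c y z - c (x * y) z + c x (y * z).
  rewrite /c mulrBr mulrBl !mulrA opprB [RHS]addrC [RHS]addrA subrKA.
  by rewrite [RHS]addrC subrKA.
pose t := \sum_i s (e i) * s (f i).
have hMs x y : h x * s y =
    t * c x y - \sum_i s (x * e i) * c (f i) y + h (x * y).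
  rewrite (sep _ (fun u v => s u * c v y)).
  - rewrite /h !mulr_suml -sumrB -big_split; apply: eq_bigr => i _ /=.
    by rewrite -mulrA coc mulrDr mulrBr !mulrA.
  - by move=> v a u w; rewrite linearP mulrDl -scalerAl.
  by move=> u a v w; rewrite cDl mulrDr -scalerAr.
exists (s \+ hL : {linear B -> A}); split=> [x|x y] /=.
  rewrite raddfD /= sK; apply/eqP; rewrite addrC -subr_eq0 addrK semitop_pi_eq0.
  exact: (subvP (radX_sub _ n)).
(* Each of the three terms multiplies an element of r by one of r^(n+1): [1 - t] is in r since the
   idempotent multiplies to 1, [s] is multiplicative modulo r, and [h] takes values in r^(n+1). *)
have -> : (s \+ hL) (x * y) - (s \+ hL) x * (s \+ hL) y =
    (1 - t) * c x y + \sum_i (s (x * e i) - s x * s (e i)) * c (f i) y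
    - h x * h y.
  have shE z : (s \+ hL) z = s z + h z by [].
  have -> : \sum_i (s (x * e i) - s x * s (e i)) * c (f i) y =
      \sum_i s (x * e i) * c (f i) y - s x * h y.
    rewrite /h mulr_sumr -sumrB; apply: eq_bigr => i _.
    by rewrite mulrBl mulrA.
  rewrite !shE mulrDr !mulrDl hMs mul1r mulNr /c.
  set H := h (x * y); set U := t * _; set T := \sum_i _.
  rewrite !opprD opprK !addrA; congr (_ - _ - _).
  by rewrite -!addrA (addrC T) !(addrCA _ (- H)) !(addrCA _ H) addNKr.
rewrite rpredB ?rpredD ?rpred_sum //.
- rewrite expvSl memv_mul ?sM // -semitop_pi_eq0 raddfB /= rmorph1 raddf_sum /=.
  by under eq_bigr => i _ do rewrite rmorphM /= !sK; rewrite ef1 subrr.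
- move=> i _; rewrite expvSl memv_mul ?sM //.
  by rewrite -semitop_pi_eq0 raddfB /= rmorphM /= !sK subrr.
by rewrite expvSl memv_mul // (subvP (radX_sub _ n)).
Qed.

Lemma wedderburn_section :
  exists s : {lrmorphism B -> A}, cancel s (@semitop_pi k A).
Proof.
have [n r0] := radical_nilpotent A; have [s [sK sM]] := approx_section n.
have sM0 x y : s (x * y) = s x * s y.
  by apply/eqP; rewrite -subr_eq0 -memv0 -r0.
(* The element [1 - s 1] is an idempotent of the nilpotent ideal r, hence 0. *)
have s1 : s 1 = 1.
  have u_r : 1 - s 1 \in r.
    by rewrite -semitop_pi_eq0 raddfB /= rmorph1 sK subrr.
  have uu : (1 - s 1) * (1 - s 1) = 1 - s 1.
    by rewrite mulrBl mul1r mulrBr mulr1 -sM0 mulr1 subrr subr0.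
  have : 1 - s 1 \in (r ^+ n.+1)%VS.
    elim: (n) => // m IHm; rewrite expvSl -uu; exact: memv_mul.
  by rewrite r0 memv0 subr_eq0 => /eqP.
exists (HB.pack_for {lrmorphism B -> A} (s : B -> A)
  (GRing.isMonoidMorphism.Build B A s (conj s1 sM0)) s).
done.
Qed.

End WedderburnSection.

(** * The radical layer and the coordinates of the radical *)

Section LayerSection.
Variables (k : fieldType) (A : falgType k).

Local Notation r := (radical A).
Local Notation B := (semitop A).
Local Notation M := (rad_layer A).
Local Notation lact := (@layer_lact k A).
Local Notation ract := (@layer_ract k A).

Lemma layer_lactZl (c : k) b m : lact (c *: b) m = c *: lact b m.
Proof.
rewrite -(semitop_piK b) -(rad_layer_piK m) -linearZ !layer_lactE -linearZ.
by congr rad_layer_pi; apply: val_inj; rewrite /= scalerAl.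
Qed.

Lemma layer_ractZl (c : k) b m : ract (c *: b) m = c *: ract b m.
Proof.
rewrite -(semitop_piK b) -(rad_layer_piK m) -linearZ !layer_ractE -linearZ.
by congr rad_layer_pi; apply: val_inj; rewrite /= scalerAr.
Qed.

Lemma layer_lact_linear m : linear (lact^~ m).
Proof. by move=> c a b; rewrite layer_lactDl layer_lactZl. Qed.

Lemma layer_ract_linear m : linear (ract^~ m).
Proof. by move=> c a b; rewrite layer_ractDl layer_ractZl. Qed.

Lemma layer_lact1 m : lact 1 m = m.
Proof.
rewrite -(rad_layer_piK m) -(rmorph1 (@semitop_pi k A)) layer_lactE.
by congr rad_layer_pi; apply: val_inj; rewrite /= mul1r.
Qed.

Lemma layer_ract1 m : ract 1 m = m.
Proof.
rewrite -(rad_layer_piK m) -(rmorph1 (@semitop_pi k A)) layer_ractE.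
by congr rad_layer_pi; apply: val_inj; rewrite /= mulr1.
Qed.

Lemma layer_lact0 m : lact 0 m = 0.
Proof. by apply: (addIr (lact 0 m)); rewrite -layer_lactDl !add0r. Qed.

Lemma layer_ract0 m : ract 0 m = 0.
Proof. by apply: (addIr (ract 0 m)); rewrite -layer_ractDl !add0r. Qed.

Lemma layer_ract_suml (I : finType) (b : I -> B) m :
  ract (\sum_i b i) m = \sum_i ract (b i) m.
Proof.
exact: (big_morph (ract^~ m) (layer_ractDl m) (layer_ract0 m)).
Qed.

Lemma layer_lact_suml (I : finType) (b : I -> B) m :
  lact (\sum_i b i) m = \sum_i lact (b i) m.
Proof.
exact: (big_morph (lact^~ m) (layer_lactDl m) (layer_lact0 m)).
Qed.

Hypothesis sepA : separable_algebra B.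

(** A k-linear section M -> r is averaged on the right ([t1]) and then on the left ([t2]), which
    makes it a bimodule map. It remains a section because the idempotent multiplies to 1. *)
Lemma layer_section (s : {lrmorphism B -> A}) :
    cancel s (@semitop_pi k A) ->
  exists t : {linear M -> A},
  [/\ forall m, t m \in r,
      forall b m, s b * t m = t (lact b m),
      forall b m, t m * s b = t (ract b m)
    & forall m (x : subvs_of r), vsval x = t m -> rad_layer_pi x = m].
Proof.
move=> sK; have [n [u [v [uv1 sep]]]] := separability_idempotent sepA.
have [t0 t0K] := @linear_section _ _ _ (@rad_layer_pi k A)
  (fun m => ex_intro _ (repr m) (rad_layer_piK m)).
pose t1 m := \sum_j vsval (t0 (ract (u j) m)) * s (v j).
pose t2 m := \sum_i s (u i) * t1 (lact (v i) m).
have t1l : linear t1.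
  move=> c x y; rewrite /t1 scaler_sumr -big_split; apply: eq_bigr => j _ /=.
  by rewrite !linearP /= mulrDl -scalerAl.
have t2l : linear t2.
  move=> c x y; rewrite /t2 scaler_sumr -big_split; apply: eq_bigr => j _ /=.
  by rewrite linearP t1l mulrDr -scalerAr.
pose t : {linear M -> A} := HB.pack t2 (GRing.isLinear.Build k M A *:%R t2 t2l).
have t1M b m : t1 (ract b m) = t1 m * s b.
  rewrite /t1 mulr_suml.
  transitivity (\sum_i vsval (t0 (ract (b * u i) m)) * s (v i)).
    by apply: eq_bigr => i _; rewrite layer_ractA.
  rewrite (sep _ (fun x y => vsval (t0 (ract x m)) * s y)).
  - by apply: eq_bigr => i _; rewrite rmorphM mulrA.
  - by move=> y c x x'; rewrite layer_ract_linear !linearP /= mulrDl -scalerAl.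
  by move=> x c y y'; rewrite linearP mulrDr -scalerAr.
have tMr b m : t m * s b = t (ract b m).
  rewrite /= /t2 mulr_suml; apply: eq_bigr => i _.
  by rewrite layer_lractA t1M mulrA.
have tMl b m : s b * t m = t (lact b m).
  rewrite /= /t2 mulr_sumr.
  transitivity (\sum_i s (b * u i) * t1 (lact (v i) m)).
    by apply: eq_bigr => i _; rewrite rmorphM mulrA.
  rewrite (sep _ (fun x y => s x * t1 (lact y m))).
  - by apply: eq_bigr => i _; rewrite layer_lactA.
  - by move=> y c x x'; rewrite linearP mulrDl -scalerAl.
  by move=> x c y y'; rewrite layer_lact_linear t1l mulrDr -scalerAr.
have t1r m : t1 m = vsval (\sum_j radr (t0 (ract (u j) m)) (s (v j))).
  by rewrite linear_sum.
have tE m : t m = vsval (\sum_i radl (s (u i))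
    (\sum_j radr (t0 (ract (u j) (lact (v i) m))) (s (v j)))).
  by rewrite linear_sum; apply: eq_bigr => i _ /=; rewrite -t1r.
exists t; split=> // [m|m x]; first by rewrite tE subvsP.
rewrite tE => /val_inj ->; rewrite linear_sum /=.
under eq_bigr => i _ do rewrite -layer_lactE sK linear_sum /=.
transitivity (\sum_i lact (u i) (lact (v i) m)); last first.
  under eq_bigr => i _ do rewrite layer_lactA.
  by rewrite -layer_lact_suml uv1 layer_lact1.
apply: eq_bigr => i _; congr (lact _ _); set m' := lact _ m.
under eq_bigr => j _ do rewrite -layer_ractE sK t0K layer_ractA.
by rewrite -layer_ract_suml uv1 layer_ract1.
Qed.

(** Averaging the coordinate forms of a k-basis of M makes them right B-linear with values in B;
    this expresses that M is a projective right B-module. *)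
Lemma layer_dual_basis :
  exists (n : nat) (w : 'I_n -> M) (f : 'I_n -> {linear M -> B}),
    (forall m, m = \sum_i ract (f i m) (w i)) /\
    (forall i b m, f i (ract b m) = f i m * b).
Proof.
have [n [u [v [uv1 sep]]]] := separability_idempotent sepA.
pose e (i : 'I_(\dim {:M})) := (vbasis {:M})`_i.
pose g i m := \sum_j coord (vbasis {:M}) i (ract (u j) m) *: v j.
have gl i : linear (g i).
  move=> c x y; rewrite /g scaler_sumr -big_split; apply: eq_bigr => j _ /=.
  by rewrite !linearP /= scalerDl scalerA.
pose f i : {linear M -> B} :=
  HB.pack (g i) (GRing.isLinear.Build k M B *:%R (g i) (gl i)).
exists (\dim {:M}), e, f.
split=> [m|i b m] /=.
  under eq_bigr => i _ do rewrite layer_ract_suml.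
  rewrite exchange_big -[LHS]layer_ract1 -uv1 layer_ract_suml.
  apply: eq_bigr => j _ /=; rewrite -layer_ractA.
  rewrite [X in ract (v j) X](coord_vbasis (memvf (ract (u j) m))).
  by rewrite linear_sum; apply: eq_bigr => i _; rewrite linearZ layer_ractZl.
rewrite /g mulr_suml.
transitivity (\sum_j coord (vbasis {:M}) i (ract (b * u j) m) *: v j).
  by apply: eq_bigr => j _; rewrite layer_ractA.
rewrite (sep _ (fun x y => coord (vbasis {:M}) i (ract x m) *: y)).
- by apply: eq_bigr => j _; rewrite scalerAl.
- by move=> y c x x'; rewrite layer_ract_linear linearP scalerDl scalerA.
by move=> x c y y'; rewrite scalerDr !scalerA mulrC.
Qed.

End LayerSection.

Section RadicalModule.
Variables (k : fieldType) (A : falgType k).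

(** The radical as a right A-module. With its inclusion [rad_val] into A it is the right ideal to
    which heredity is applied. *)
Definition rad_mod : Type := subvs_of (radical A).
HB.instance Definition _ := GRing.Zmodule.on rad_mod.

Definition rad_act (a : A^c) (x : rad_mod) : rad_mod := radr x a.

Fact rad_actA a b x : rad_act a (rad_act b x) = rad_act (a * b) x.
Proof. by apply: val_inj; rewrite /= -mulrA. Qed.
Fact rad_act1 : left_id 1 rad_act.
Proof. by move=> x; apply: val_inj; rewrite /= mulr1. Qed.
Fact rad_actDr : right_distributive rad_act +%R.
Proof. by move=> a x y; apply: val_inj; rewrite /= mulrDl. Qed.
Fact rad_actDl x : {morph rad_act^~ x : a b / a + b}.
Proof. by move=> a b; apply: val_inj; rewrite /= mulrDr. Qed.
HB.instance Definition _ := GRing.Zmodule_isLmodule.Build A^c rad_mod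
  rad_actA rad_act1 rad_actDr rad_actDl.

Definition rad_val (x : rad_mod) : (A^c)^o := vsval (x : subvs_of (radical A)).
Fact rad_val_linear : linear rad_val. Proof. by []. Qed.
HB.instance Definition _ := GRing.isLinear.Build A^c rad_mod (A^c)^o *:%R
  rad_val rad_val_linear.

End RadicalModule.

Section RadicalCoordinates.
Variables (k : fieldType) (A : falgType k).

Local Notation r := (radical A).
Local Notation B := (semitop A).
Local Notation M := (rad_layer A).
Local Notation ract := (@layer_ract k A).

Variables (s : {lrmorphism B -> A}) (t : {linear M -> A}).
Hypothesis sK : cancel s (@semitop_pi k A).
Hypothesis tr : forall m, t m \in r.
Hypothesis tMr : forall b m, t m * s b = t (ract b m).
Hypothesis tK : forall m (x : subvs_of r), vsval x = t m -> rad_layer_pi x = m.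
Variables (n : nat) (w : 'I_n -> M) (f : 'I_n -> {linear M -> B}).
Hypothesis fE : forall m, m = \sum_i ract (f i m) (w i).
Hypothesis fM : forall i b m, f i (ract b m) = f i m * b.

Let q (a : 'I_n -> A) : A := \sum_i t (w i) * a i.

(** Nakayama's argument: the right ideal W generated by the lifts satisfies r <= W + r^2, hence r <=
    W + r^m for every m >= 1, and some power of r is 0. *)
Lemma rad_span_gen :
  (r <= \sum_i amull (t (w i)) @: {:A})%VS.
Proof.
set W := (\sum_i _)%VS.
have WM : (W * {:A} <= W)%VS.
  apply/prodvP=> x a /memv_sumP[y yW ->] _; rewrite mulr_suml.
  apply: memv_sumr => i _; have /memv_imgP[z _ ->] := yW i isT.
  rewrite lfunE /= -mulrA -[_ * (z * a)](lfunE (t (w i) \*o idfun)).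
  by rewrite memv_img ?memvf.
have rW2 : (r <= W + r * r)%VS.
  apply/subvP=> x xr; rewrite -[x](subrK (t (rad_layer_pi (Subvs xr)))) addrC.
  have := rad_layer_pi_eq (Subvs xr) (Subvs (tr (rad_layer_pi (Subvs xr)))).
  rewrite /= (tK (erefl : vsval (Subvs _) = _)) eqxx => /esym xt.
  rewrite memv_add // [rad_layer_pi _]fE linear_sum.
  apply: memv_sumr => i _ /=; rewrite -tMr.
  by rewrite -[_ * s _](lfunE (t (w i) \*o idfun)) memv_img ?memvf.
have step m : (r ^+ m.+1 <= W + r ^+ m.+2)%VS.
  case: m => [|m]; first by rewrite expv1 expvSl expv1.
  rewrite expvSl; apply: subv_trans (prodvSl _ rW2) _.
  rewrite prodvDl addvS //; first by apply: subv_trans (prodvSr _ (subvf _)) WM.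
  by rewrite -prodvA.
have [N r0] := radical_nilpotent A.
suff : (r <= W + r ^+ N.+1)%VS by rewrite r0 addv0.
elim: (N) => [|m IHm]; first by rewrite addvSr.
apply: subv_trans IHm _; rewrite subv_add addvSl; exact: step.
Qed.

Lemma rad_coord_ex x : x \in r -> exists a, x = q a.
Proof.
move=> /(subvP rad_span_gen) /memv_sumP[y yW ->].
have ex i : exists a, y i = t (w i) * a.
  by have /memv_imgP[a _ ->] := yW i isT; exists a; rewrite lfunE.
exists (fun i => sval (cid (ex i))); apply: eq_bigr => i _.
by case: cid.
Qed.

Let qr a : q a \in r.
Proof. by apply: rpred_sum => i _; rewrite radicalMr. Qed.

Local Notation X := {ffun 'I_n -> (A^c)^o}.
Let qX (a : X) : rad_mod A := Subvs (qr a).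

Let qX_linear : linear qX.
Proof.
move=> c a b; apply: val_inj; rewrite /= /q mulr_suml -big_split.
by apply: eq_bigr => i _ /=; rewrite !ffunE -mulrA -mulrDr.
Qed.

Hypothesis hA : hereditary A.

(** The map [q] from A^n onto r splits since r is projective. *)
Let splitting :
  exists G : {linear rad_mod A -> X},
    forall x, q (G x) = vsval (x : subvs_of r).
Proof.
pose p : {linear X -> rad_mod A} :=
  HB.pack qX (GRing.isLinear.Build A^c X (rad_mod A) *:%R qX qX_linear).
have psurj y : exists x, p x = y.
  have [a ya] := rad_coord_ex (subvsP (y : subvs_of r)).
  exists (finfun a); apply: val_inj; rewrite /= ya.
  by apply: eq_bigr => i _; rewrite ffunE.
have rad_val_inj : injective (@rad_val k A) by exact: val_inj.
have [G GK] := hA rad_val_inj (idfun : {linear rad_mod A -> _}) psurj.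
by exists G => x; have /(congr1 val) := GK x.
Qed.

(* Let E be the projection of A^n onto the projective cover [r / r^2 (x) A]   *)
(* of r, and P the projection defined by a splitting of [q]. Then K = E - P   *)
(* is an idempotent with entries in the nilpotent ideal r, hence P = E.       *)
Lemma rad_coordinates : exists psi : 'I_n -> {additive A -> A},
  [/\ forall a, a = s (semitop_pi a) + \sum_i t (w i) * psi i a,
      forall i b, psi i (s b) = 0
    & forall i m a, psi i (t m * a) = s (f i m) * a].
Proof.
have [G0 G0K] := splitting.
pose E : 'M[A]_n := \matrix_(j, i) s (f j (w i)).
(* Composing the splitting with [E] forces its values into the image of [E]; it remains a splitting
   because [q] absorbs [E]. *)
pose G (x : subvs_of r) j := \sum_i E j i * (G0 x i : A).
have qE a : q (fun j => \sum_i E j i * a i) = q a.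
  rewrite /q; under eq_bigr => j _ do rewrite mulr_sumr.
  rewrite exchange_big; apply: eq_bigr => i _ /=.
  rewrite [in RHS](fE (w i)) linear_sum mulr_suml.
  by apply: eq_bigr => j _; rewrite /= mxE mulrA tMr.
have EE : E *m E = E.
  apply/matrixP=> j l; rewrite !mxE.
  under eq_bigr => i _ do rewrite !mxE -rmorphM -fM.
  by rewrite -rmorph_sum -linear_sum -fE.
have GD x y j : G (x + y) j = G x j + G y j.
  rewrite /G -big_split; apply: eq_bigr => i _ /=.
  by rewrite raddfD ffunE mulrDr.
have GM x a j : G (radr x a) j = G x j * a.
  rewrite /G mulr_suml; apply: eq_bigr => i _.
  have -> : radr x a = (a : A^c) *: (x : rad_mod A) by [].
  by rewrite linearZ ffunE /= -mulrA.
have Gsum (I : finType) (x : I -> subvs_of r) j :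
    G (\sum_i x i) j = \sum_i G (x i) j.
  apply: (big_morph (G^~ j)) => [y z|]; first exact: GD.
  by apply: (addIr (G 0 j)); rewrite -GD !add0r.
have GK x : q (G x) = vsval x by rewrite qE G0K.
pose tS m : subvs_of r := Subvs (tr m).
pose P : 'M[A]_n := \matrix_(j, i) G (tS (w i)) j.
have Gq a (x : subvs_of r) j : vsval x = q a -> G x j = \sum_i P j i * a i.
  move=> xE; have -> : x = \sum_i radr (tS (w i)) (a i).
    by apply: val_inj; rewrite /= linear_sum /= xE.
  by rewrite Gsum; apply: eq_bigr => i _; rewrite GM mxE.
have tq m : t m = q (fun i => s (f i m)).
  by rewrite [in LHS](fE m) linear_sum; apply: eq_bigr => i _; rewrite tMr.
have PE : P *m E = P.
  apply/matrixP=> j l; rewrite !mxE.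
  rewrite [RHS](Gq (fun i => s (f i (w l)))); last exact: tq.
  by apply: eq_bigr => i _; rewrite !mxE.
have PP : P *m P = P.
  apply/matrixP=> j l; rewrite !mxE.
  rewrite [RHS](Gq (fun i => P i l)).
    by apply: eq_bigr => i _; rewrite !mxE.
  by rewrite -GK; apply: eq_bigr => i _; rewrite mxE.
have EP : E *m P = P.
  apply/matrixP=> j l; rewrite mxE [RHS]mxE /G.
  under eq_bigr => i _ do rewrite [P i l]mxE /G mulr_sumr.
  rewrite exchange_big; apply: eq_bigr => i _ /=.
  move: (EE) => /matrixP/(_ j i) <-; rewrite mxE mulr_suml.
  by apply: eq_bigr => h _; apply: mulrA.
pose K := E - P.
have KK : K *m K = K.
  by rewrite mulmxBl !mulmxBr EE EP PE PP subrr subr0.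
(* The columns of [K] are killed by [q]. Reading this relation in r / r^2 and applying [f j] shows
   that [E *m K], which is [K], vanishes modulo r. *)
have Kr j l : K j l \in r.
  have qK : q (fun i => K i l) = 0.
    transitivity (q (fun i => s (f i (w l))) - q (G (tS (w l)))).
      by rewrite /q -sumrB; apply: eq_bigr => i _; rewrite !mxE mulrBr.
    by rewrite -tq GK subrr.
  have EK : E *m K = K by rewrite mulmxBr EE EP.
  move: (EK) => /matrixP/(_ j l) <-; rewrite mxE -semitop_pi_eq0 raddf_sum /=.
  under eq_bigr => i _ do rewrite rmorphM mxE /= sK -fM.
  rewrite -linear_sum.
  rewrite (_ : \sum_i _ = rad_layer_pi (Subvs (qr (fun i => K i l)))).
    by rewrite (_ : Subvs _ = 0) ?linear0 //; apply: val_inj.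
  rewrite (_ : Subvs _ = \sum_i radr (tS (w i)) (K i l)); last first.
    by apply: val_inj; rewrite /= linear_sum.
  rewrite linear_sum; apply: eq_bigr => i _ /=; rewrite -layer_ractE.
  by rewrite (tK (erefl : vsval (tS _) = _)).
have K0 : K = 0.
  have [N r0] := radical_nilpotent A.
  apply/matrixP=> j l; rewrite [RHS]mxE; apply/eqP; rewrite -memv0 -r0.
  elim: (N) j l => [|m IHm] j l; first exact: Kr.
  move: (KK) => /matrixP/(_ j l) <-; rewrite mxE rpred_sum // => i _.
  by rewrite expvSl memv_mul.
have G_t m j : G (tS m) j = s (f j m).
  rewrite (Gq (fun i => s (f i m))); last exact: tq.
  rewrite [in RHS](fE m) linear_sum rmorph_sum; apply: eq_bigr => i _ /=.
  rewrite fM rmorphM; congr (_ * _).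
  move: K0 => /matrixP/(_ j i); rewrite !mxE => /eqP.
  by rewrite subr_eq0 => /eqP/esym.
have dr a : a - s (semitop_pi a) \in r.
  by rewrite -semitop_pi_eq0 raddfB /= sK subrr.
pose psi0 i a := G (Subvs (dr a)) i.
have psiB i : zmod_morphism (psi0 i).
  move=> a b; apply/eqP; rewrite eq_sym subr_eq -GD; apply/eqP; congr (G _ i).
  by apply: val_inj; rewrite /= !raddfB /= opprK addrACA subrK addrK.
pose psi i : {additive A -> A} := HB.pack (psi0 i)
  (GRing.isZmodMorphism.Build A A (psi0 i) (psiB i)).
exists psi; split=> [a|i b|i m a] /=.
- by rewrite [X in _ + X](GK (Subvs (dr a))) addrC subrK.
- rewrite /psi0 (_ : Subvs _ = 0); last by apply: val_inj; rewrite /= sK subrr.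
  by apply: (addIr (G 0 i)); rewrite -GD !add0r.
rewrite -G_t -GM; congr (G _ i); apply: val_inj => /=.
rewrite rmorphM /= (eqP (_ : semitop_pi (t m) == 0)) ?semitop_pi_eq0 //.
by rewrite mul0r raddf0 subr0.
Qed.

End RadicalCoordinates.

(** * The tensor algebra presentation *)

(** Bounds the tensor degree of an element. It justifies truncating the recursion of [ext_step] and
    yields the induction principle [vanishes_ind]. *)
Fixpoint vanishes (A : zmodType) (n : nat) (psi : 'I_n -> A -> A)
    (d : nat) (a : A) : Prop :=
  if d is d'.+1 then forall i, vanishes psi d' (psi i a) else a = 0.

(* A presentation of A as the tensor algebra of r / r^2 over A / r: the       *)
(* multiplication [r / r^2 (x) A -> r] is invertible, its inverse having the  *)
(* coordinates [tp_psi], and iterating these coordinates kills A.             *)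
Record tensor_presentation (k : fieldType) (A : falgType k) :=
  TensorPresentation {
  tp_sec : {lrmorphism semitop A -> A};
  tp_lay : {additive rad_layer A -> A};
  tp_n : nat;
  tp_w : 'I_tp_n -> rad_layer A;
  tp_f : 'I_tp_n -> rad_layer A -> semitop A;
  tp_psi : 'I_tp_n -> {additive A -> A};
  tp_secK : cancel tp_sec (@semitop_pi k A);
  tp_lay_rad : forall m, tp_lay m \in radical A;
  tp_layMl : forall b m, tp_sec b * tp_lay m = tp_lay (layer_lact b m);
  tp_layMr : forall b m, tp_lay m * tp_sec b = tp_lay (layer_ract b m);
  tp_fE : forall m, m = \sum_i layer_ract (tp_f i m) (tp_w i);
  tp_psiE : forall a,
    a = tp_sec (semitop_pi a) + \sum_i tp_lay (tp_w i) * tp_psi i a;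
  tp_psi_sec : forall i b, tp_psi i (tp_sec b) = 0;
  tp_psi_lay : forall i m a, tp_psi i (tp_lay m * a) = tp_sec (tp_f i m) * a;
  tp_depth : nat;
  tp_vanishes : forall a, vanishes tp_psi tp_depth a }.

Section Vanishing.
Variables (k : fieldType) (A : falgType k).

Local Notation r := (radical A).
Local Notation B := (semitop A).
Local Notation M := (rad_layer A).

Variables (s : {rmorphism B -> A}) (t : {additive M -> A}).
Hypothesis tr : forall m, t m \in r.
Hypothesis tMl : forall b m, s b * t m = t (layer_lact b m).
Hypothesis tMr : forall b m, t m * s b = t (layer_ract b m).
Variables (n : nat) (w : 'I_n -> M) (f : 'I_n -> M -> B).
Hypothesis fE : forall m, m = \sum_i layer_ract (f i m) (w i).
Variable psi : 'I_n -> {additive A -> A}.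
Hypothesis psiE : forall a, a = s (semitop_pi a) + \sum_i t (w i) * psi i a.
Hypothesis psi_sec : forall i b, psi i (s b) = 0.
Hypothesis psi_lay : forall i m a, psi i (t m * a) = s (f i m) * a.

(** Left multiplication by [s b] mixes the coordinates through the matrix of left multiplication by
    b on M in the dual basis. *)
Lemma psi_secM j b a :
  psi j (s b * a) = \sum_i s (f j (layer_lact b (w i))) * psi i a.
Proof.
rewrite [in LHS](psiE a) mulrDr -rmorphM raddfD /= psi_sec add0r mulr_sumr.
rewrite raddf_sum; apply: eq_bigr => i _ /=.
by rewrite mulrA tMl psi_lay.
Qed.

Lemma sec_layE b m : s b * t m = \sum_j t (w j) * s (f j (layer_lact b m)).
Proof.
rewrite tMl {1}[layer_lact b m]fE raddf_sum; apply: eq_bigr => j _ /=.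
by rewrite tMr.
Qed.

(* The component of a in degrees at least d of the tensor algebra.            *)
Fixpoint tail (d : nat) (a : A) : A :=
  if d is d'.+1 then \sum_i t (w i) * tail d' (psi i a) else a.

Lemma tailD d a b : tail d (a + b) = tail d a + tail d b.
Proof.
elim: d a b => //= d IHd a b; rewrite -big_split; apply: eq_bigr => i _ /=.
by rewrite raddfD IHd mulrDr.
Qed.

Lemma tail0 d : tail d 0 = 0.
Proof. by apply: (addIr (tail d 0)); rewrite -tailD !add0r. Qed.

Lemma tail_sum (I : finType) d (a : I -> A) :
  tail d (\sum_i a i) = \sum_i tail d (a i).
Proof. exact: (big_morph _ (tailD d) (tail0 d)). Qed.

Lemma tail_secM d b a : tail d (s b * a) = s b * tail d a.
Proof.
elim: d b a => //= d IHd b a.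
under eq_bigr => j _ do rewrite psi_secM tail_sum mulr_sumr.
rewrite exchange_big mulr_sumr; apply: eq_bigr => i _ /=.
rewrite mulrA sec_layE mulr_suml; apply: eq_bigr => j _.
by rewrite IHd mulrA.
Qed.

Lemma tail_rad d a : tail d.+1 a \in (r ^+ d.+1)%VS.
Proof.
elim: d a => [|d IHd] a; first by rewrite rpred_sum // => i _; apply: radicalMr.
by rewrite rpred_sum // => i _; rewrite expvSl memv_mul ?tr // IHd.
Qed.

(** Each [psi j] strips one tensor factor, lowering the degree by one. *)
Lemma psi_tail d j a : psi j (tail d.+1 a) = tail d (psi j a).
Proof.
rewrite /= raddf_sum /= [in RHS](psiE a) raddfD /= psi_sec add0r raddf_sum.
by rewrite tail_sum; apply: eq_bigr => i _ /=; rewrite !psi_lay tail_secM.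
Qed.

Lemma tail_vanishes d a : tail d a = 0 -> vanishes psi d a.
Proof.
elim: d a => //= d IHd a a0 j; apply: IHd.
by rewrite -psi_tail /= a0 raddf0.
Qed.

Lemma psi_vanishes : exists d, forall a, vanishes psi d a.
Proof.
have [d r0] := radical_nilpotent A; exists d.+1 => a.
by apply: tail_vanishes; apply/eqP; rewrite -memv0 -r0 tail_rad.
Qed.

End Vanishing.

Lemma tensor_presentation_ex (k : fieldType) (A : falgType k) :
    hereditary A -> separable_algebra (semitop A) ->
  exists T : tensor_presentation A, True.
Proof.
move=> hA sepA; have [s sK] := wedderburn_section sepA.
have [t [tr tMl tMr tK]] := layer_section sepA sK.
have [n [w [f [fE fM]]]] := layer_dual_basis sepA.
have [psi [psiE psi_sec psi_lay]] := rad_coordinates sK tr tMr tK fE fM hA.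
have [d psi_d] := psi_vanishes tr tMl tMr fE psiE psi_sec psi_lay.
by exists (TensorPresentation sK tr tMl tMr fE psiE psi_sec psi_lay psi_d).
Qed.

(** * Extending a B-module with a map V (x)_B M -> V to an A-module *)

Section Extension.
Variables (k : fieldType) (A : falgType k) (T : tensor_presentation A).

Local Notation B := (semitop A).
Local Notation M := (rad_layer A).
Local Notation s := (tp_sec T).
Local Notation t := (tp_lay T).
Local Notation w := (@tp_w k A T).
Local Notation psi := (@tp_psi k A T).

Variables (V : zmodType) (act : V -> B -> V) (phi : V -> M -> V).
Hypothesis actDl : forall u v b, act (u + v) b = act u b + act v b.
Hypothesis actDr : forall v b c, act v (b + c) = act v b + act v c.
Hypothesis actA : forall v b c, act (act v b) c = act v (b * c).
Hypothesis act1 : forall v, act v 1 = v.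
Hypothesis phiDl : forall u v m, phi (u + v) m = phi u m + phi v m.
Hypothesis phiDr : forall v m m', phi v (m + m') = phi v m + phi v m'.
Hypothesis phi_act : forall v b m, phi (act v b) m = phi v (layer_lact b m).
Hypothesis act_phi : forall v b m, act (phi v m) b = phi v (layer_ract b m).

(** The contribution to v . a of the tensor degrees of a below d. The recursion is on d because
    [psi] is not structurally decreasing; at depth [tp_depth] nothing is lost. *)
Fixpoint ext_step (d : nat) (v : V) (a : A) : V :=
  if d is d'.+1
  then act v (semitop_pi a) + \sum_i ext_step d' (phi v (w i)) (psi i a)
  else 0.

Definition ext_act := ext_step (tp_depth T).

Lemma ext_stepDl d u v a :
  ext_step d (u + v) a = ext_step d u a + ext_step d v a.
Proof.
elim: d u v a => [|d IHd] u v a /=; first by rewrite addr0.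
rewrite actDl addrACA -big_split; congr (_ + _); apply: eq_bigr => i _ /=.
by rewrite phiDl IHd.
Qed.

Lemma ext_stepDr d v a b :
  ext_step d v (a + b) = ext_step d v a + ext_step d v b.
Proof.
elim: d v a b => [|d IHd] v a b /=; first by rewrite addr0.
rewrite raddfD actDr addrACA -big_split; congr (_ + _).
by apply: eq_bigr => i _ /=; rewrite raddfD IHd.
Qed.

Lemma ext_actDl u v a : ext_act (u + v) a = ext_act u a + ext_act v a.
Proof. exact: ext_stepDl. Qed.
Lemma ext_actDr v a b : ext_act v (a + b) = ext_act v a + ext_act v b.
Proof. exact: ext_stepDr. Qed.

Lemma ext_act0r v : ext_act v 0 = 0.
Proof. by apply: (addIr (ext_act v 0)); rewrite -ext_actDr !add0r. Qed.
Lemma ext_act0l a : ext_act 0 a = 0.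
Proof. by apply: (addIr (ext_act 0 a)); rewrite -ext_actDl !add0r. Qed.

Lemma ext_act_suml (I : finType) (v : I -> V) a :
  ext_act (\sum_i v i) a = \sum_i ext_act (v i) a.
Proof.
exact: (big_morph (ext_act^~ a) (fun u v => ext_actDl u v a) (ext_act0l a)).
Qed.
Lemma ext_act_sumr (I : finType) v (a : I -> A) :
  ext_act v (\sum_i a i) = \sum_i ext_act v (a i).
Proof. exact: (big_morph _ (ext_actDr v) (ext_act0r v)). Qed.
Lemma phi_sumr (I : finType) v (m : I -> M) :
  phi v (\sum_i m i) = \sum_i phi v (m i).
Proof.
apply: (big_morph _ (phiDr v)).
by apply: (addIr (phi v 0)); rewrite -phiDr !add0r.
Qed.

Lemma ext_step_stable d v a :
  vanishes psi d a -> ext_step d v a = ext_step d.+1 v a.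
Proof.
elim: d v a => [|d IHd] v a => [-> /=|va].
  rewrite raddf0 big1 ?addr0 //; apply: (addIr (act v 0)).
  by rewrite -actDr !add0r.
rewrite /= -/ext_step; congr (_ + _); apply: eq_bigr => i _.
exact/IHd/va.
Qed.

(** The equation that characterizes the action: at full depth one further unfolding changes
    nothing. *)
Lemma ext_actE v a :
  ext_act v a = act v (semitop_pi a) + \sum_i ext_act (phi v (w i)) (psi i a).
Proof. by rewrite /ext_act ext_step_stable //; apply: tp_vanishes. Qed.

(** Induction on tensor degree. *)
Lemma vanishes_ind (P : A -> Prop) :
  P 0 -> (forall a, (forall i, P (psi i a)) -> P a) -> forall a, P a.
Proof.
move=> P0 PS a; have := tp_vanishes T a.
elim: (tp_depth T) a => [|d IHd] a /= => [->|va] //.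
by apply: PS => i; apply: IHd.
Qed.

Lemma ext_act_sec v b : ext_act v (s b) = act v b.
Proof.
rewrite ext_actE tp_secK big1 ?addr0 // => i _.
by rewrite tp_psi_sec ext_act0r.
Qed.

(** After [psi_secM] and the induction hypothesis, the dual basis identity reassembles the sum over
    j into the element b . w_i of M, and b then moves across [phi]. *)
Lemma ext_act_secM v b a : ext_act v (s b * a) = ext_act (act v b) a.
Proof.
elim/vanishes_ind: a v b => [|a IHa] v b; first by rewrite mulr0 !ext_act0r.
rewrite !ext_actE rmorphM /= tp_secK actA; congr (_ + _).
under eq_bigr => j _ do
  rewrite (psi_secM (@tp_layMl _ _ T) (@tp_psiE _ _ T) (@tp_psi_sec _ _ T)
             (@tp_psi_lay _ _ T)) ext_act_sumr.
rewrite exchange_big; apply: eq_bigr => i _ /=.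
under eq_bigr => j _ do rewrite IHa act_phi.
by rewrite -ext_act_suml -phi_sumr -tp_fE phi_act.
Qed.

Lemma ext_act_layM v m a : ext_act v (t m * a) = ext_act (phi v m) a.
Proof.
have act0 u : act u 0 = 0 by apply: (addIr (act u 0)); rewrite -actDr !add0r.
rewrite ext_actE (eqP (_ : semitop_pi (t m * a) == 0)); last first.
  by rewrite semitop_pi_eq0 radicalMr // tp_lay_rad.
rewrite act0 add0r.
under eq_bigr => j _ do rewrite tp_psi_lay ext_act_secM act_phi.
by rewrite -ext_act_suml -phi_sumr -tp_fE.
Qed.

Lemma ext_act_lay v m : ext_act v (t m) = phi v m.
Proof. by rewrite -[t m]mulr1 ext_act_layM -(rmorph1 s) ext_act_sec act1. Qed.

Lemma ext_act1 v : ext_act v 1 = v.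
Proof. by rewrite -(rmorph1 s) ext_act_sec act1. Qed.

(** Decomposing a by [tp_psiE] reduces associativity to left factors in the images of B and M,
    treated by [ext_act_secM] and [ext_act_layM]. *)
Lemma ext_actA v a b : ext_act (ext_act v a) b = ext_act v (a * b).
Proof.
elim/vanishes_ind: a v => [|a IHa] v.
  by rewrite mul0r !ext_act0r ext_act0l.
rewrite [ext_act v a]ext_actE [in RHS](tp_psiE T a) mulrDl ext_actDl ext_actDr.
rewrite ext_act_secM mulr_suml ext_act_suml ext_act_sumr; congr (_ + _).
by apply: eq_bigr => i _; rewrite IHa -mulrA ext_act_layM.
Qed.

End Extension.

(** * Equivalences of categories *)

Section EquivalenceCriterion.
Variables (C D : category) (G : functor D C).

Definition isomorphic_objects (K : category) (x y : K) : Prop :=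
  exists (u : hom x y) (v : hom y x),
    comp_hom u v = id_hom y /\ comp_hom v u = id_hom x.

Definition fully_faithful : Prop :=
  forall x y (g : hom (G x) (G y)), exists! f : hom x y, fmap G f = g.

Definition essentially_surjective : Prop :=
  forall c, exists d, isomorphic_objects (G d) c.

(** A quasi-inverse is obtained by choosing, for each object of C, an isomorphic image of an object
    of D, and lifting the conjugated morphisms through full faithfulness. *)
Lemma equivalence_criterion :
  fully_faithful -> essentially_surjective -> equivalent_categories C D.
Proof.
move=> ff es.
pose F0 c := sval (cid (es c)).
pose Fu c : hom (G (F0 c)) c := sval (cid (svalP (cid (es c)))).
pose Fv c : hom c (G (F0 c)) := sval (cid (svalP (cid (svalP (cid (es c)))))).
have [uv vu] : (forall c, comp_hom (Fu c) (Fv c) = id_hom c) /\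
    (forall c, comp_hom (Fv c) (Fu c) = id_hom (G (F0 c))).
  by split=> c; case: (svalP (cid (svalP (cid (svalP (cid (es c))))))).
pose lift x y (g : hom (G x) (G y)) : hom x y := sval (cid (ff x y g)).
have liftK x y (g : hom (G x) (G y)) : fmap G (lift x y g) = g.
  by have [] := svalP (cid (ff x y g)).
have inj x y (f f' : hom x y) : fmap G f = fmap G f' -> f = f'.
  move=> E; have [h [_ hu]] := ff x y (fmap G f').
  by rewrite -(hu f E) (hu f' erefl).
pose Fm c c' (f : hom c c') := lift (F0 c) (F0 c')
  (comp_hom (Fv c') (comp_hom f (Fu c))).
have Fm_id c : Fm c c (id_hom c) = id_hom (F0 c).
  by apply: inj; rewrite liftK fmap_id comp_id_l vu.
have Fm_comp c c' c'' (g : hom c' c'') (f : hom c c') :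
    Fm c c'' (comp_hom g f) = comp_hom (Fm c' c'' g) (Fm c c' f).
  apply: inj; rewrite fmap_comp !liftK -!comp_homA; do 2 congr comp_hom.
  by rewrite (comp_homA (Fu c')) uv comp_id_l.
pose F := Functor Fm_id Fm_comp; exists F, G; split.
  exists Fu, Fv; split=> // c c' f /=.
  by rewrite liftK comp_homA uv comp_id_l.
exists (fun d => lift _ _ (Fu (G d))), (fun d => lift _ _ (Fv (G d))).
split=> [x y f|x|x] /=; apply: inj.
- by rewrite !fmap_comp !liftK comp_homA uv comp_id_l.
- by rewrite fmap_comp !liftK vu fmap_id.
by rewrite fmap_comp !liftK uv fmap_id.
Qed.

End EquivalenceCriterion.

Section Restriction.
Variables (C D : category) (G : functor D C) (P : C -> Prop) (Q : D -> Prop).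
Hypothesis QP : forall d, Q d <-> P (G d).

Definition restrict_functor :
    functor (full_subcategory Q) (full_subcategory P) :=
  @Functor (full_subcategory Q) (full_subcategory P)
    (fun d => exist P (G (sval d)) (proj1 (QP (sval d)) (svalP d)))
    (fun x y f => fmap G f) (fun x => fmap_id G (sval x))
    (fun x y z g f => fmap_comp G g f).

Lemma restrict_equivalence :
    fully_faithful G -> essentially_surjective G ->
    (forall c c', isomorphic_objects c c' -> P c' -> P c) ->
  equivalent_categories (full_subcategory P) (full_subcategory Q).
Proof.
move=> ff es Piso; apply: (@equivalence_criterion _ _ restrict_functor).
  by move=> x y g; apply: ff.
move=> [c Pc]; have [d Gdc] := es c.
exists (exist Q d (proj2 (QP d) (Piso _ _ Gdc Pc))).
by have [u [v uv]] := Gdc; exists u, v.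
Qed.

End Restriction.

(** * Corners of right modules *)

Section RightModules.
Variables (R : nzRingType) (V : lmodType R^c).
Implicit Types (v w : V) (a b : R).

Definition rmul v a : V := (a : R^c) *: v.

Lemma rmulA v a b : rmul (rmul v a) b = rmul v (a * b).
Proof. exact: scalerA. Qed.
Lemma rmul1 v : rmul v 1 = v. Proof. exact: scale1r. Qed.
Lemma rmul0r v : rmul v 0 = 0. Proof. exact: scale0r. Qed.
Lemma rmul0l a : rmul 0 a = 0. Proof. exact: scaler0. Qed.
Lemma rmulDr v a b : rmul v (a + b) = rmul v a + rmul v b.
Proof. exact: scalerDl. Qed.
Lemma rmulDl v w a : rmul (v + w) a = rmul v a + rmul w a.
Proof. exact: scalerDr. Qed.
Lemma rmulBl v w a : rmul (v - w) a = rmul v a - rmul w a.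
Proof. exact: scalerBr. Qed.
Lemma rmul_suml (I : finType) (v : I -> V) a :
  rmul (\sum_i v i) a = \sum_i rmul (v i) a.
Proof. exact: scaler_sumr. Qed.
Lemma rmul_sumr (I : finType) v (a : I -> R) :
  rmul v (\sum_i a i) = \sum_i rmul v (a i).
Proof. exact: scaler_suml. Qed.

(** Allows generators indexed by products and dependent sums, as needed in [corner_fin_gen]. *)
Lemma fin_genP :
  fin_gen V <-> exists (I : finType) (g : I -> V),
    forall v, exists c : I -> R, v = \sum_i rmul (g i) (c i).
Proof.
split=> [[n [g gP]]|[I [g gP]]]; first by exists 'I_n, g.
exists #|I|, (fun i => g (enum_val i)) => v; have [c ->] := gP v.
exists (fun i => c (enum_val i)).
by rewrite (reindex _ (onW_bij _ (@enum_val_bij I))).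
Qed.

End RightModules.

(** Models the embedding of a block of B into A, which sends 1 to an idempotent in general different
    from 1. *)
Record nonunital_morphism (S R : nzRingType) := NonunitalMorphism {
  nu_fun :> {additive S -> R};
  nu_mul : {morph nu_fun : x y / x * y} }.

Section Corner.
Variables (R S : nzRingType) (e : nonunital_morphism S R).

Let eM : {morph e : x y / x * y} := @nu_mul _ _ e.

(** The submodule N . e(1) over S, described as the fixed points of the idempotent e(1). *)
Definition corner_pred (N : lmodType R^c) : {pred N} :=
  fun x => rmul x (e 1) == x.

Fact corner_zmod_closed (N : lmodType R^c) : zmod_closed (@corner_pred N).
Proof.
split=> [|x y /eqP xe /eqP ye]; first by rewrite /in_mem /= /corner_pred rmul0l.
by rewrite /in_mem /= /corner_pred rmulBl xe ye.
Qed.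
HB.instance Definition _ (N : lmodType R^c) :=
  GRing.isZmodClosed.Build N (@corner_pred N) (corner_zmod_closed N).

Record corner (N : lmodType R^c) := Corner {
  corner_val : N; corner_valP : corner_val \in @corner_pred N }.
HB.instance Definition _ (N : lmodType R^c) := [isSub for @corner_val N].
HB.instance Definition _ (N : lmodType R^c) := [Choice of corner N by <:].
HB.instance Definition _ (N : lmodType R^c) :=
  [SubChoice_isSubZmodule of corner N by <:].

Section CornerModule.
Variable N : lmodType R^c.
Implicit Types (x y : corner N).

Lemma corner_val1 x : rmul (corner_val x) (e 1) = corner_val x.
Proof. exact/eqP/(corner_valP x). Qed.

Lemma corner_rmulP (x : N) a : rmul x (e a) \in @corner_pred N.
Proof. by rewrite /in_mem /= /corner_pred rmulA -eM mulr1. Qed.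

Definition corner_proj (x : N) : corner N := Corner (corner_rmulP x 1).

Definition corner_act (a : S^c) x : corner N :=
  Corner (corner_rmulP (corner_val x) a).

Fact corner_actA (a b : S^c) x :
  corner_act a (corner_act b x) = corner_act (a * b) x.
Proof. by apply: val_inj; rewrite /= rmulA -eM. Qed.
Fact corner_act1 : left_id 1 corner_act.
Proof. by move=> x; apply: val_inj; apply: corner_val1. Qed.
Fact corner_actDr : right_distributive corner_act +%R.
Proof. by move=> a x y; apply: val_inj; rewrite /= rmulDl. Qed.
Fact corner_actDl x : {morph (fun a : S^c => corner_act a x) : a b / a + b}.
Proof. by move=> a b; apply: val_inj; rewrite /= raddfD rmulDr. Qed.
HB.instance Definition _ := GRing.Zmodule_isLmodule.Build S^c (corner N)
  corner_actA corner_act1 corner_actDr corner_actDl.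

Lemma corner_val_rmul x a : corner_val (rmul x a) = rmul (corner_val x) (e a).
Proof. by []. Qed.

Fact corner_val_zmod : zmod_morphism (@corner_val N).
Proof. by []. Qed.
HB.instance Definition _ := GRing.isZmodMorphism.Build (corner N) N
  (@corner_val N) corner_val_zmod.

Lemma corner_projK x : corner_proj (corner_val x) = x.
Proof. by apply: val_inj; rewrite /= corner_val1. Qed.

End CornerModule.

Section CornerMap.
Variables (N N' : lmodType R^c) (f : {linear N -> N'}).

Lemma linear_rmul x a : f (rmul x a) = rmul (f x) a.
Proof. exact: linearZ. Qed.

Fact corner_mapP (x : corner N) : f (corner_val x) \in @corner_pred N'.
Proof. by rewrite /in_mem /= /corner_pred -linear_rmul corner_val1. Qed.

Definition corner_map (x : corner N) : corner N' := Corner (corner_mapP x).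

Fact corner_map_linear : linear corner_map.
Proof.
move=> a x y; apply: val_inj; rewrite /= raddfD /=; congr (_ + _).
exact: linear_rmul.
Qed.
HB.instance Definition _ := GRing.isLinear.Build S^c (corner N) (corner N') *:%R
  corner_map corner_map_linear.

End CornerMap.

End Corner.

Arguments corner_map {R S} e {N N'} f.
Arguments corner_proj {R S} e {N} x.
Arguments corner_pred {R S} e {N}.

Section TensorLinear.
Variables (R S : nzRingType) (V : lmodType R^c) (M : bimodule R S).
Variables (W : lmodType S^c) (f : V -> M -> W).
Hypothesis balf : balanced f.
Hypothesis fZ : forall v (b : S^c) m, f v (b *: m) = b *: f v m.

Fact tensor_lift_linear : linear (tensor_lift f).
Proof.
move=> b x y; have fB := tensor_lift_zmod balf.
have f0 : tensor_lift f 0 = 0 by have := fB 0 0; rewrite !subrr.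
have fD u v : tensor_lift f (u + v) = tensor_lift f u + tensor_lift f v.
  by rewrite -{1}[v]opprK fB -[- v]sub0r fB f0 sub0r opprK.
rewrite fD; congr (_ + _).
move: x; apply: tensor_ext => [u v|u v|v m].
- by rewrite scalerBr fB.
- by rewrite /= fB scalerBr.
by rewrite /= tensZr !(tensor_liftE balf) fZ.
Qed.

Definition tensor_linear : {linear tensor V M -> W} :=
  HB.pack (tensor_lift f)
    (GRing.isLinear.Build S^c (tensor V M) W *:%R (tensor_lift f)
       tensor_lift_linear).

Lemma tensor_linearE v m : tensor_linear (tens v m) = f v m.
Proof. exact: tensor_liftE. Qed.

End TensorLinear.

(** * Representations and modules *)

Section Vertices.
Variables (k : fieldType) (A : falgType k).
Variables (p : nat) (E : 'I_p -> {aspace semitop A}).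
Hypothesis hE : simple_decomposition E.

Local Notation B := (semitop A).
Local Notation M := (rad_layer A).
Local Notation eps i := (algid (E i)).

Lemma simple_idealMl i b x : x \in E i -> b * x \in E i.
Proof.
move=> xE; have [/(_ i) [/andP[LE _] _ _] _ _] := hE.
by apply: (subvP LE); rewrite memv_mul ?memvf.
Qed.

Lemma simple_idealMr i b x : x \in E i -> x * b \in E i.
Proof.
move=> xE; have [/(_ i) [/andP[_ RE] _ _] _ _] := hE.
by apply: (subvP RE); rewrite memv_mul ?memvf.
Qed.

Lemma simple_ideal_disjoint i j x : i != j -> x \in E i -> x \in E j -> x = 0.
Proof.
move=> nij xi xj; have [_ /directv_sumP dE _] := hE.
apply/eqP; rewrite -memv0 -(dE i isT) memv_cap xi.
by rewrite (subvP (sumv_sup j _ (subvv _))) // eq_sym.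
Qed.

(** The product lies in both ideals, whose sum is direct. *)
Lemma simple_ideal_orth i j x y : i != j -> x \in E i -> y \in E j -> x * y = 0.
Proof.
move=> nij xi yj; apply: (simple_ideal_disjoint nij).
  exact: simple_idealMr.
exact: simple_idealMl.
Qed.

Lemma eps_orth i j : i != j -> eps i * eps j = 0.
Proof. by move=> nij; apply: (simple_ideal_orth nij); apply: memv_algid. Qed.

(** Both sides equal [eps i * b * eps i], since [eps i] is an identity of the two-sided ideal
    [E i]. *)
Lemma eps_central i b : eps i * b = b * eps i.
Proof.
have bl : b * eps i \in E i by rewrite simple_idealMl ?memv_algid.
have br : eps i * b \in E i by rewrite simple_idealMr ?memv_algid.
by rewrite -[LHS](algidr br) -mulrA (algidl bl).
Qed.

Lemma eps_sum : \sum_i eps i = 1.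
Proof.
have [_ _ sE] := hE.
have : 1 \in (\sum_i E i)%VS by rewrite sE memvf.
case/memv_sumP=> u uE u1; rewrite [RHS]u1; apply: eq_bigr => i _.
rewrite -[LHS]mulr1 u1 mulr_sumr (bigD1 i) //= big1 ?addr0 => [|j nij].
  exact: algidl (uE i isT).
by apply: (@simple_ideal_orth i j); rewrite 1?eq_sym ?memv_algid ?uE.
Qed.

Definition vertex_part i (b : B) : subvs_of (E i) :=
  Subvs (simple_idealMl b (memv_algid (E i))).

Lemma vertex_partE i (b : subvs_of (E i)) : vertex_part i (vsval b) = b.
Proof. by apply: val_inj; apply/algidr/subvsP. Qed.

Lemma vertex_part_neq i j (b : subvs_of (E i)) :
  i != j -> vertex_part j (vsval b) = 0.
Proof.
move=> nij; apply: val_inj.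
exact: (simple_ideal_orth nij (subvsP b) (memv_algid (E j))).
Qed.

Lemma vertex_partD i a b :
  vertex_part i (a + b) = vertex_part i a + vertex_part i b.
Proof. by apply: val_inj; rewrite /= mulrDl. Qed.

Lemma vertex_partM i a b :
  vertex_part i (a * b) = vertex_part i a * vertex_part i b.
Proof.
apply: val_inj; rewrite /= -[in RHS]mulrA [eps i * _]mulrA eps_central.
by rewrite -[b * _ * _]mulrA (algidl (memv_algid _)) mulrA.
Qed.

Lemma vertex_part1 i : vertex_part i 1 = 1.
Proof. by apply: val_inj; rewrite /= mul1r. Qed.

Definition arrow_part i j (m : M) : arrow_bimodule (E i) (E j) :=
  Subvs (arrow_space_gen m (memv_algid (E i)) (memv_algid (E j))).

Lemma arrow_partD i j m n :
  arrow_part i j (m + n) = arrow_part i j m + arrow_part i j n.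
Proof. by apply: val_inj; rewrite /= !raddfD. Qed.

Lemma arrow_lact_eps i j (m : arrow_bimodule (E i) (E j)) :
  layer_lact (eps i) (vsval m) = vsval m.
Proof. exact: arrow_space1l (subvsP m). Qed.

Lemma arrow_ract_eps i j (m : arrow_bimodule (E i) (E j)) :
  layer_ract (eps j) (vsval m) = vsval m.
Proof. exact: arrow_space1r (subvsP m). Qed.

Lemma arrow_partE i j (m : arrow_bimodule (E i) (E j)) :
  arrow_part i j (vsval m) = m.
Proof. by apply: val_inj; rewrite /= arrow_lact_eps arrow_ract_eps. Qed.

Lemma arrow_part_actl i j (b : B) m :
  arrow_part i j (layer_lact b m) =
    lact (arrow_bimodule (E i) (E j)) (vertex_part i b) (arrow_part i j m).
Proof.
apply: val_inj; rewrite /= layer_lractA !layer_lactA.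
by rewrite -mulrA (algidl (memv_algid _)) eps_central -layer_lractA.
Qed.

Lemma arrow_part_actr i j (b : B) m :
  arrow_part i j (layer_ract b m) =
    (vertex_part j b : (subvs_of (E j))^c) *: (arrow_part i j m).
Proof.
apply: val_inj; rewrite /= layer_lractA !layer_ractA.
by rewrite -[in RHS]eps_central mulrA (algidl (memv_algid _)) eps_central.
Qed.

End Vertices.

(** * The functor from A-modules to representations *)

Section CornerFunctor.
Variables (k : fieldType) (A : falgType k) (T : tensor_presentation A).
Variables (p : nat) (E : 'I_p -> {aspace semitop A}).

Local Notation Q := (related_quiver E).
Local Notation RM := (related_modulation E).

Definition vertex_add i : {additive subvs_of (E i) -> A} := tp_sec T \o vsval.

Fact vertex_addM i : {morph vertex_add i : x y / x * y}.
Proof. by move=> x y; rewrite /= rmorphM. Qed.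

Definition vertex_emb i := NonunitalMorphism (@vertex_addM i).

Section Module.
Variable N : lmodType A^c.
Implicit Types (x : N).

Local Notation C i := (corner (vertex_emb i) N).

Lemma arrow_mulP i j (x : C i) (m : arrow_bimodule (E i) (E j)) :
  rmul (corner_val x) (tp_lay T (vsval m)) \in corner_pred (vertex_emb j).
Proof.
rewrite /in_mem /= /corner_pred rmulA /= tp_layMr.
by rewrite [layer_ract _ _]arrow_ract_eps.
Qed.

Definition arrow_mul i j (x : C i) (m : arrow_bimodule (E i) (E j)) : C j :=
  Corner (arrow_mulP x m).

Fact arrow_mul_balanced i j : balanced (@arrow_mul i j).
Proof.
split=> *; apply: val_inj => /=; first by rewrite rmulDl.
  by rewrite !raddfD rmulDr.
by rewrite rmulA /= tp_layMl.
Qed.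

Fact arrow_mulZ i j (x : C i) (b : (subvs_of (E j))^c) m :
  arrow_mul x (b *: m) = b *: @arrow_mul i j x m.
Proof. by apply: val_inj; rewrite /= rmulA /= tp_layMr. Qed.

Definition corner_rep : representation RM :=
  @Representation p Q RM (fun i => C i)
    (fun i j _ => tensor_linear (@arrow_mul_balanced i j) (@arrow_mulZ i j)).

Lemma corner_rep_map i j (a : arrow Q i j) (x : C i) m :
  rep_map corner_rep a (tens x m) = arrow_mul x m.
Proof. exact: tensor_linearE. Qed.

End Module.

Section Morphism.
Variables (N N' : lmodType A^c) (f : {linear N -> N'}).

Fact corner_rep_comm i j (a : arrow Q i j) t :
  corner_map (vertex_emb j) f (rep_map (corner_rep N) a t) =
  rep_map (corner_rep N') a (tensor_map (corner_map (vertex_emb i) f) t).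
Proof.
move: t; apply: tensor_ext => [x y|x y|x m].
- by rewrite !raddfB.
- by rewrite !raddfB.
rewrite tensor_mapE !corner_rep_map.
by apply: val_inj; rewrite /= linear_rmul.
Qed.

Definition corner_rep_hom : rep_hom (corner_rep N) (corner_rep N') :=
  @RepHom p Q RM (corner_rep N) (corner_rep N')
    (fun i => corner_map (vertex_emb i) f) corner_rep_comm.

End Morphism.

Definition corner_functor : functor (Mod A) (Rep RM).
Proof.
refine (@Functor (Mod A) (Rep RM) corner_rep corner_rep_hom _ _).
- by move=> N; apply: rep_hom_eq => i x; apply: val_inj.
- by move=> N N' N'' g f; apply: rep_hom_eq => i x; apply: val_inj.
Defined.

End CornerFunctor.

(** * Full faithfulness of the corner functor *)

Section FullyFaithful.
Variables (k : fieldType) (A : falgType k) (T : tensor_presentation A).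
Variables (p : nat) (E : 'I_p -> {aspace semitop A}).
Hypothesis hE : simple_decomposition E.

Local Notation s := (tp_sec T).
Local Notation t := (tp_lay T).
Local Notation Q := (related_quiver E).
Local Notation emb := (@vertex_emb k A T p E).

Lemma arrow_part0 i j m : ~~ arrow Q i j -> arrow_part E i j m = 0.
Proof.
rewrite negbK => /eqP E0; apply: val_inj; apply/eqP.
by rewrite -memv0 -E0 subvsP.
Qed.

Section Projections.
Variable N : lmodType A^c.
Implicit Types (x y : N).

Lemma corner_projD i x y :
  corner_proj (emb i) (x + y) = corner_proj (emb i) x + corner_proj (emb i) y.
Proof. by apply: val_inj; rewrite /= rmulDl. Qed.

Lemma corner_proj_sum x : \sum_i corner_val (corner_proj (emb i) x) = x.
Proof.
rewrite -[RHS]rmul1 -(rmorph1 s) -(eps_sum hE) rmorph_sum rmul_sumr.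
exact: eq_bigr.
Qed.

Lemma corner_proj_neq i j (x : corner (emb i) N) :
  i != j -> corner_proj (emb j) (corner_val x) = 0.
Proof.
move=> nij; apply: val_inj; rewrite /= -corner_val1 rmulA -rmorphM /=.
by rewrite (eps_orth hE nij) rmorph0 rmul0r.
Qed.

Lemma corner_proj_sec i x b :
  corner_proj (emb i) (rmul x (s b)) =
  rmul (corner_proj (emb i) x) (vertex_part hE i b).
Proof.
apply: val_inj; rewrite /= !rmulA -!rmorphM /=.
by rewrite mulrA (eps_central hE) -mulrA (algidl (memv_algid _)).
Qed.

(** Inserting the sum of the [eps i], which is 1, splits the action of m into the components eps_i m
    eps_j. *)
Lemma corner_proj_lay j x m :
  corner_proj (emb j) (rmul x (t m)) =
  \sum_i arrow_mul (corner_proj (emb i) x) (arrow_part E i j m).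
Proof.
apply: val_inj; rewrite raddf_sum /= rmulA tp_layMr.
under eq_bigr => i _ do rewrite rmulA tp_layMl -layer_lractA layer_lactA
  (algidl (memv_algid _)).
rewrite -rmul_sumr -raddf_sum /= -layer_lact_suml (eps_sum hE).
by rewrite layer_lact1.
Qed.

End Projections.

Section Gluing.
Variables (N N' : lmodType A^c).
Variable al : rep_hom (corner_rep T E N) (corner_rep T E N').

Local Notation al_ i :=
  (rep_hom_at al i : {linear corner (emb i) N -> corner (emb i) N'}).

(** N is the direct sum of its corners, so a morphism of representations determines this map. *)
Definition glue (x : N) : N' :=
  \sum_i corner_val (al_ i (corner_proj (emb i) x)).

Lemma glueD x y : glue (x + y) = glue x + glue y.
Proof.
rewrite /glue -big_split; apply: eq_bigr => i _ /=.
by rewrite corner_projD !raddfD.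
Qed.

Lemma glue_sec x b : glue (rmul x (s b)) = rmul (glue x) (s b).
Proof.
rewrite /glue rmul_suml; apply: eq_bigr => i _.
rewrite corner_proj_sec linear_rmul corner_val_rmul.
rewrite -[in RHS]corner_val1 rmulA; congr rmul.
by rewrite /= -rmorphM (eps_central hE).
Qed.

(** Along an arrow this is the commutation rule of [al]; where there is no arrow the bimodule is
    0. *)
Lemma al_arrow_mul i j (x : corner (emb i) N) m :
  al_ j (arrow_mul x (arrow_part E i j m)) =
  arrow_mul (al_ i x) (arrow_part E i j m).
Proof.
have [a|/arrow_part0 ->] := boolP (arrow Q i j).
  rewrite -(corner_rep_map a) -[LHS]/(rep_hom_at al j _) rep_hom_comm.
  by rewrite tensor_mapE corner_rep_map.
have mul0 (L : lmodType A^c) (y : corner (emb i) L) :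
    arrow_mul y (0 : arrow_bimodule (E i) (E j)) = 0.
  by apply: val_inj; rewrite /= raddf0 rmul0r.
by rewrite !mul0 linear0.
Qed.

Lemma glue_lay x m : glue (rmul x (t m)) = rmul (glue x) (t m).
Proof.
rewrite /glue rmul_suml.
under eq_bigr => j _ do rewrite corner_proj_lay linear_sum raddf_sum /=.
rewrite exchange_big; apply: eq_bigr => i _ /=.
under eq_bigr => j _ do rewrite al_arrow_mul /=.
rewrite -rmul_sumr -raddf_sum /= -layer_ract_suml (eps_sum hE) layer_ract1.
by rewrite -tp_layMl -rmulA [rmul _ (s _)]corner_val1.
Qed.

(** Linearity over the images of B and M suffices, by induction on tensor degree. *)
Lemma glue_rmul x a : glue (rmul x a) = rmul (glue x) a.
Proof.
have glue0 : glue 0 = 0 by apply: (addIr (glue 0)); rewrite -glueD !add0r.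
elim/(@vanishes_ind _ _ T): a x => [|a IHa] x; first by rewrite !rmul0r.
rewrite (tp_psiE T a) !rmulDr glueD glue_sec; congr (_ + _).
rewrite !rmul_sumr (big_morph glue glueD glue0); apply: eq_bigr => i _.
by rewrite -!rmulA IHa glue_lay.
Qed.

Fact glue_linear : linear glue.
Proof. by move=> a x y; rewrite glueD; congr (_ + _); apply: glue_rmul. Qed.

Lemma glue_corner i (x : corner (emb i) N) :
  glue (corner_val x) = corner_val (al_ i x).
Proof.
rewrite /glue (bigD1 i) //= corner_projK big1 ?addr0 // => j nij.
by rewrite corner_proj_neq 1?eq_sym // linear0.
Qed.

End Gluing.

Lemma corner_functor_ff : fully_faithful (corner_functor T E).
Proof.
move=> N N' al.
pose f : {linear N -> N'} :=
  HB.pack (glue al)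
    (GRing.isLinear.Build A^c N N' *:%R (glue al) (glue_linear al)).
exists f; split=> [|g galE].
  by apply: rep_hom_eq => i x; apply: val_inj; apply: glue_corner.
apply: linear_eq => x; rewrite -(corner_proj_sum x) !linear_sum.
apply: eq_bigr => i _; rewrite -[LHS]/(glue al _) glue_corner -galE.
by [].
Qed.

End FullyFaithful.

Section RepIso.
Variables (p : nat) (Q : pv_quiver p) (RM : pseudo_modulation Q).

Lemma rep_iso (X Y : representation RM) (f : rep_hom X Y) :
    (forall i, bijective (rep_hom_at f i)) ->
  isomorphic_objects (X : Rep RM) (Y : Rep RM).
Proof.
move=> bij.
have inv i : exists g : rep_mod Y i -> rep_mod X i,
    cancel (rep_hom_at f i) g /\ cancel g (rep_hom_at f i).
  by have [g fK gK] := bij i; exists g.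
pose g0 i := sval (cid (inv i)).
have fK i : cancel (rep_hom_at f i) (g0 i) by case: (svalP (cid (inv i))).
have gK i : cancel (g0 i) (rep_hom_at f i) by case: (svalP (cid (inv i))).
have gl i : linear (g0 i).
  by move=> a x y; apply: (can_inj (fK i)); rewrite linearP !gK.
pose g i : {linear rep_mod Y i -> rep_mod X i} := HB.pack (g0 i)
  (GRing.isLinear.Build _ (rep_mod Y i) (rep_mod X i) *:%R (g0 i) (gl i)).
have gc i j (e : arrow Q i j) u :
    g j (rep_map Y e u) = rep_map X e (tensor_map (g i) u).
  apply: (can_inj (fK j)); rewrite [LHS]gK rep_hom_comm; congr (rep_map Y e _).
  rewrite -[RHS]tensor_map_comp -[LHS]tensor_map_id; congr (tensor_map _ u).
  by apply: linear_eq => x; rewrite /= gK.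
exists f, (RepHom gc).
by split; apply: rep_hom_eq => i x /=; rewrite ?gK ?fK.
Qed.

End RepIso.

Section DependentProduct.
Variables (I : Type) (V : I -> zmodType).

(** Serves as the direct sum of the vertex modules, there being finitely many vertices. *)
Definition dprod : Type := forall i, V i.
HB.instance Definition _ := gen_eqMixin dprod.
HB.instance Definition _ := gen_choiceMixin dprod.

Lemma dprodP (u v : dprod) : (forall i, u i = v i) -> u = v.
Proof. exact: functional_extensionality_dep. Qed.

Definition dprod_zero : dprod := fun i => 0.
Definition dprod_opp (u : dprod) : dprod := fun i => - u i.
Definition dprod_add (u v : dprod) : dprod := fun i => u i + v i.

Fact dprod_addA : associative dprod_add.
Proof. by move=> u v w; apply: dprodP => i; apply: addrA. Qed.
Fact dprod_addC : commutative dprod_add.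
Proof. by move=> u v; apply: dprodP => i; apply: addrC. Qed.
Fact dprod_add0 : left_id dprod_zero dprod_add.
Proof. by move=> u; apply: dprodP => i; apply: add0r. Qed.
Fact dprod_addN : left_inverse dprod_zero dprod_opp dprod_add.
Proof. by move=> u; apply: dprodP => i; apply: addNr. Qed.
HB.instance Definition _ := GRing.isZmodule.Build dprod
  dprod_addA dprod_addC dprod_add0 dprod_addN.

End DependentProduct.

(** * Essential surjectivity of the corner functor *)

Section EssentiallySurjective.
Variables (k : fieldType) (A : falgType k) (T : tensor_presentation A).
Variables (p : nat) (E : 'I_p -> {aspace semitop A}).
Hypothesis hE : simple_decomposition E.

Local Notation B := (semitop A).
Local Notation M := (rad_layer A).
Local Notation s := (tp_sec T).
Local Notation t := (tp_lay T).
Local Notation Q := (related_quiver E).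
Local Notation RM := (related_modulation E).
Local Notation emb := (@vertex_emb k A T p E).
Local Notation Mij i j := (arrow_bimodule (E i) (E j)).

Variable X : representation RM.
Local Notation X_ i := (rep_mod X i : lmodType (subvs_of (E i))^c).

(** A representation has a structure map only along arrows. The default value 0 is the right one
    elsewhere, as the bimodule vanishes there. *)
Definition arrow_act i j (x : X_ i) (m : Mij i j) : X_ j :=
  if @idP (arrow Q i j) is ReflectT a then rep_map X a (tens x m) else 0.

Lemma arrow_actE i j (a : arrow Q i j) (x : X_ i) m :
  arrow_act x m = rep_map X a (tens x m).
Proof.
rewrite /arrow_act; case: {-}_ / idP => [a'|/(_ a)//].
by rewrite (bool_irrelevance a' a).
Qed.

Lemma arrow_actDl i j (x y : X_ i) (m : Mij i j) :
  arrow_act (x + y) m = arrow_act x m + arrow_act y m.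
Proof.
rewrite /arrow_act; case: {-}_ / idP => [a|_]; last by rewrite addr0.
by rewrite tensDl raddfD.
Qed.
Lemma arrow_actDr i j (x : X_ i) (m n : Mij i j) :
  arrow_act x (m + n) = arrow_act x m + arrow_act x n.
Proof.
rewrite /arrow_act; case: {-}_ / idP => [a|_]; last by rewrite addr0.
by rewrite tensDr raddfD.
Qed.
Lemma arrow_act_rmul i j (x : X_ i) b (m : Mij i j) :
  arrow_act (rmul x b) m = arrow_act x (lact (Mij i j) b m).
Proof.
rewrite /arrow_act; case: {-}_ / idP => // a.
by rewrite [tens (rmul _ _) _]tensZ.
Qed.
Lemma rmul_arrow_act i j (x : X_ i) (m : Mij i j) b :
  rmul (arrow_act x m) b = arrow_act x ((b : (subvs_of (E j))^c) *: m).
Proof.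
rewrite /arrow_act; case: {-}_ / idP => [a|_]; last by rewrite rmul0l.
by rewrite -tensZr linearZ.
Qed.
Lemma arrow_act0l i j (m : Mij i j) : arrow_act (0 : X_ i) m = 0.
Proof. by apply: (addIr (arrow_act 0 m)); rewrite -arrow_actDl !add0r. Qed.
Definition total : Type := dprod (fun i => X_ i).
HB.instance Definition _ := GRing.Zmodule.on total.
Implicit Types (u v : total).

Definition total_act v (b : B) : total :=
  fun i => rmul (v i) (vertex_part hE i b).
Definition total_phi v (m : M) : total :=
  fun j => \sum_i arrow_act (v i) (arrow_part E i j m).

Fact total_actDl u v b : total_act (u + v) b = total_act u b + total_act v b.
Proof. by apply: dprodP => i; apply: rmulDl. Qed.
Fact total_actDr v b c : total_act v (b + c) = total_act v b + total_act v c.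
Proof.
by apply: dprodP => i; rewrite /total_act vertex_partD; apply: rmulDr.
Qed.
Fact total_actA v b c : total_act (total_act v b) c = total_act v (b * c).
Proof. by apply: dprodP => i; rewrite /total_act rmulA vertex_partM. Qed.
Fact total_act1 v : total_act v 1 = v.
Proof.
by apply: dprodP => i; rewrite /total_act vertex_part1; apply: rmul1.
Qed.
Fact total_phiDl u v m : total_phi (u + v) m = total_phi u m + total_phi v m.
Proof.
apply: dprodP => j; rewrite -[RHS]big_split; apply: eq_bigr => i _.
exact: arrow_actDl.
Qed.
Fact total_phiDr v m n : total_phi v (m + n) = total_phi v m + total_phi v n.
Proof.
apply: dprodP => j; rewrite -[RHS]big_split; apply: eq_bigr => i _.
by rewrite arrow_partD; apply: arrow_actDr.
Qed.
Fact total_phi_act v b m :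
  total_phi (total_act v b) m = total_phi v (layer_lact b m).
Proof.
apply: dprodP => j; apply: eq_bigr => i _.
by rewrite (arrow_part_actl hE) -arrow_act_rmul.
Qed.
Fact total_act_phi v b m :
  total_act (total_phi v m) b = total_phi v (layer_ract b m).
Proof.
apply: dprodP => j; rewrite /total_act rmul_suml; apply: eq_bigr => i _.
by rewrite (arrow_part_actr hE) -rmul_arrow_act.
Qed.

Definition total_ext := ext_act T total_act total_phi.

Fact total_mulA (a b : A^c) v :
  total_ext (total_ext v b) a = total_ext v (a * b).
Proof.
exact: (ext_actA T total_actDl total_actDr total_actA total_phiDl total_phiDr
  total_phi_act total_act_phi).
Qed.
Fact total_mul1 : left_id (1 : A^c) (fun a v => total_ext v a).
Proof.
by move=> v; apply: (ext_act1 T _ total_actDr total_act1).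
Qed.
Fact total_mulDr : right_distributive (fun (a : A^c) v => total_ext v a) +%R.
Proof. by move=> a u v; apply: (ext_actDl T total_actDl total_phiDl). Qed.
Fact total_mulDl v : {morph (fun a : A^c => total_ext v a) : a b / a + b}.
Proof. by move=> a b; apply: (ext_actDr T _ total_actDr). Qed.

Definition total_module : lmodType A^c :=
  HB.pack total (GRing.Zmodule_isLmodule.Build A^c total
    total_mulA total_mul1 total_mulDr total_mulDl).

Lemma total_rmul_sec v b : rmul (v : total_module) (s b) = total_act v b.
Proof. exact: (ext_act_sec T _ total_actDr). Qed.

Lemma total_rmul_lay v m : rmul (v : total_module) (t m) = total_phi v m.
Proof.
exact: (ext_act_lay T total_actDl total_actDr total_actA total_act1 total_phiDl
  total_phiDr total_phi_act total_act_phi).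
Qed.

Local Notation N := total_module.

Definition total_proj i (x : corner (emb i) N) : X_ i :=
  (corner_val x : total) i.

Fact total_proj_linear i : linear (@total_proj i).
Proof.
move=> b x y; rewrite /total_proj.
rewrite -[LHS]/((rmul (corner_val x) (s (vsval (b : subvs_of (E i)))) : total) i
                + (corner_val y : total) i).
by rewrite total_rmul_sec /total_act vertex_partE.
Qed.
HB.instance Definition _ i := GRing.isLinear.Build (subvs_of (E i))^c
  (corner (emb i) N) (X_ i) *:%R (@total_proj i) (@total_proj_linear i).

Lemma total_corner_neq i j (x : corner (emb i) N) :
  i != j -> (corner_val x : total) j = 0.
Proof.
move=> nij; rewrite -corner_val1 [rmul _ _]total_rmul_sec /total_act.
by rewrite vertex_part_neq // rmul0r.
Qed.

Lemma total_proj_comm i j (a : arrow Q i j) z :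
  @total_proj j (rep_map (corner_rep T E N) a z) =
  rep_map X a (tensor_map (@total_proj i) z).
Proof.
move: z; apply: tensor_ext => [x y|x y|x m].
- by rewrite !raddfB.
- by rewrite !raddfB.
rewrite tensor_mapE corner_rep_map /total_proj /= total_rmul_lay /total_phi.
(* An element of the corner at i has no component at any other vertex. *)
rewrite (bigD1 i) //= big1 ?addr0 => [|i' nii]; last first.
  by rewrite total_corner_neq 1?eq_sym // arrow_act0l.
by rewrite arrow_partE (arrow_actE a).
Qed.

Definition total_rep_hom : rep_hom (corner_rep T E N) X :=
  @RepHom p Q RM (corner_rep T E N) X (fun i => @total_proj i) total_proj_comm.

Lemma total_proj_bij i : bijective (@total_proj i).
Proof.
(* The inverse places x at the vertex i and 0 elsewhere. *)
pose inj (x : X_ i) : total := dfwith (fun j => 0 : X_ j) x.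
have injP x : (inj x : N) \in corner_pred (emb i).
  rewrite /in_mem /= /corner_pred; apply/eqP; rewrite [LHS]total_rmul_sec.
  apply: dprodP => j; rewrite /total_act /inj.
  case: dfwithP => [|j' nij]; last by rewrite rmul0l.
  by rewrite vertex_partE rmul1.
exists (fun x => Corner (injP x)) => x; last exact: dfwith_in.
apply: val_inj; apply: dprodP => j; rewrite /= /inj.
by case: dfwithP => // j' nij; rewrite total_corner_neq.
Qed.

Lemma total_rep_iso :
  isomorphic_objects (corner_rep T E N : Rep RM) (X : Rep RM).
Proof. by apply: (@rep_iso _ _ _ _ _ total_rep_hom); apply: total_proj_bij. Qed.

End EssentiallySurjective.

(** * Finitely generated objects *)

Lemma fin_gen_surj (R : nzRingType) (V W : lmodType R^c) (f : {linear V -> W}) :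
  (forall y, exists x, f x = y) -> fin_gen V -> fin_gen W.
Proof.
move=> fsurj [n [g gP]]; exists n, (f \o g) => y; have [x <-] := fsurj y.
have [c ->] := gP x; exists c; rewrite linear_sum.
by apply: eq_bigr => i _; rewrite linearZ.
Qed.

Section FinitelyGenerated.
Variables (k : fieldType) (A : falgType k) (T : tensor_presentation A).
Variables (p : nat) (E : 'I_p -> {aspace semitop A}).
Hypothesis hE : simple_decomposition E.

Local Notation emb := (@vertex_emb k A T p E).

(** As A is finite-dimensional, generators of N times a k-basis of A span N over k, and their
    projections span each corner. Conversely, generators of all corners together generate N. *)
Lemma corner_fin_gen (N : lmodType A^c) :
  fin_gen N <->
  forall i, fin_gen (corner (emb i) N : lmodType (subvs_of (E i))^c).
Proof.
split=> [[n [g gP]] i|genN]; apply/fin_genP.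
  pose b (j : 'I_(\dim {:A})) : A := (vbasis {:A})`_j.
  pose h l j : corner (emb i) N := corner_proj (emb i) (rmul (g l) (b j)).
  exists ('I_n * 'I_(\dim {:A}))%type, (fun u => h u.1 u.2) => x.
  have [c xE] := gP (corner_val x).
  (* Only scalar multiples of the identity of [E i] are needed as coefficients. *)
  pose d l j : subvs_of (E i) := (coord (vbasis {:A}) j (c l : A))%:A.
  exists (fun u => d u.1 u.2).
  rewrite -(pair_bigA _ (fun l j => rmul (h l j) (d l j))) /=.
  apply: val_inj; rewrite raddf_sum -[LHS]corner_val1 [in LHS]xE rmul_suml.
  apply: eq_bigr => l _; rewrite raddf_sum -[_ *: g l]/(rmul (g l) (c l)) rmulA.
  rewrite [X in rmul _ (X * _)](coord_vbasis (memvf (c l : A))).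
  rewrite mulr_suml rmul_sumr; apply: eq_bigr => j _ /=.
  rewrite !rmulA linearZ /=; congr rmul.
  rewrite -scalerAl -!scalerAr; congr (_ *: (_ * _)).
  by rewrite -rmorphM (algidl (memv_algid _)).
pose gen i := cid (genN i).
pose n i := sval (gen i).
pose g i := sval (cid (svalP (gen i))).
exists {i : 'I_p & 'I_(n i)}, (fun u => corner_val (g (tag u) (tagged u))) => x.
have ex i : exists c : 'I_(n i) -> subvs_of (E i),
    corner_proj (emb i) x = \sum_l rmul (g i l) (c l).
  exact: (svalP (cid (svalP (gen i)))).
pose c i := sval (cid (ex i)).
exists (fun u => tp_sec T (vsval (c (tag u) (tagged u)))).
rewrite -[LHS](corner_proj_sum T hE).
transitivity (\sum_i \sum_(l < n i)
    rmul (corner_val (g i l)) (tp_sec T (vsval (c i l)))); last first.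
  by rewrite sig_big_dep.
by apply: eq_bigr => i _; rewrite (svalP (cid (ex i))) raddf_sum.
Qed.

End FinitelyGenerated.

Theorem corollary3p3 (k : fieldType) (A : falgType k) (hA : hereditary A)
    (s : nat) (E : 'I_s -> {aspace semitop A}) (hE : simple_decomposition E)
    (hsep : separable_algebra (semitop A)) :
  equivalent_categories (Rep (related_modulation E)) (Mod A) /\
  equivalent_categories (rep (related_modulation E)) (mod A).
Proof.
have [T _] := tensor_presentation_ex hA hsep.
have ff := corner_functor_ff (T := T) hE.
have es : essentially_surjective (corner_functor T E).
  by move=> X; exists (total_module T hE X); apply: total_rep_iso.
split; first exact: equivalence_criterion ff es.
(* Besides [corner_fin_gen], finite generation must be invariant under isomorphism of
   representations; the inverse isomorphism is onto at each vertex. *)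
apply: (restrict_equivalence _ ff es) => [N|X Y [u [v [_ vu]]] genY i].
  exact: corner_fin_gen.
apply: (fin_gen_surj (f := rep_hom_at v i)) (genY i) => x.
exists (rep_hom_at u i x).
exact: (congr1 (fun f : rep_hom X X => rep_hom_at f i x) vu).
Qed.
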